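(* Consider the infinite Poisson model with parameters $\lambda>0$, $K>0$, $\beta>2$ and shadowing variable $S>0$ of arbitrary distribution with $\mathbf{E}[S^{2/\beta}]<\infty$, and let $N\ge 0$ be a constant (the noise power). Put $a=\lambda\pi\,\mathbf{E}[S^{2/\beta}]/K^2$. Then for every $t\ge 1$, $$\mathbf{P}\{\mathrm{SINR}\ge t\}=\frac{2t^{-2/\beta}}{\Gamma\left(1+\frac{2}{\beta}\right)}\int_0^\infty r\,e^{-r^2\Gamma(1-2/\beta)-Na^{-\beta/2}r^\beta}\,dr.$$
   Context: Infinite Poisson model: $\Phi=\{X_i\}_{i\in\mathbb{N}}$ is a homogeneous Poisson point process of intensity $\lambda$ on $\mathbb{R}^2$; $(S_i)_{i\in\mathbb{N}}$ are i.i.d. positive random variables, independent of $\Phi$, with the same distribution as $S$. The propagation losses are $L_{X_i}=\frac{(K|X_i|)^\beta}{S_i}$, the path-loss factor is $L=\inf_{i\in\mathbb{N}}L_{X_i}$, and $$\mathrm{SINR}=\frac{1/L}{N+\left(\sum_{i\in\mathbb{N}}\frac{1}{L_{X_i}}-\frac1L\right)}.$$ $\Gamma$ is the Euler gamma function. *)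

(* Defs.v *)
From HB Require Import structures.
From mathcomp Require Import all_boot all_order all_algebra.
From mathcomp Require Import finmap.
From mathcomp Require Import all_classical all_reals all_analysis.
From mathcomp Require Import measurable_realfun.

Set Implicit Arguments.
Unset Strict Implicit.
Unset Printing Implicit Defensive.

Import Order.TTheory GRing.Theory Num.Theory.
Import numFieldNormedType.Exports.

Local Open Scope classical_set_scope.
Local Open Scope ring_scope.

(* Euler's Gamma function; the integral converges for x > 0, the only case in
   which it is used. *)
Definition Gamma (R : realType) (x : R) : R :=
  \int[lebesgue_measure]_(u in `]0, +oo[) (u `^ (x - 1) * expR (- u)).

Section independence.
Context d (T : measurableType d) (R : realType) (P : probability T R).

Definition mutually_independent d' (T' : measurableType d') (I : choiceType)
    (Y : I -> T -> T') : Prop :=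
  forall (J : {fset I}) (B : I -> set T'), (forall i, measurable (B i)) ->
    P (\bigcap_(i in [set` J]) (Y i @^-1` B i)) =
    (\big[*%E/1]_(i <- J) P (Y i @^-1` B i))%E.

Definition sigma_family d' (T' : measurableType d') (I : Type)
    (Y : I -> T -> T') : set (set T) :=
  <<s \bigcup_i preimage_set_system setT (Y i) measurable >>.

Definition independent_families d1 (T1 : measurableType d1)
    d2 (T2 : measurableType d2) (I1 I2 : Type)
    (Y : I1 -> T -> T1) (Z : I2 -> T -> T2) : Prop :=
  forall A B, sigma_family Y A -> sigma_family Z B ->
    P (A `&` B) = (P A * P B)%E.

End independence.

Section poisson_process.
Context d (T : measurableType d) (R : realType) (P : probability T R).

(* The library's [poisson_pmf] is the constant 1 at rate 0, which is not the
   degenerate Poisson law; the explicit formula also covers rate 0, which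
   occurs here for Lebesgue-null sets. *)
Definition poisson_distributed (Y : T -> \bar R) (m : R) : Prop :=
  forall k : nat,
    P (Y @^-1` [set k%:R%:E]) = (m ^+ k / k`!%:R * expR (- m))%:E.

Definition area : set (R * R) -> \bar R :=
  (@lebesgue_measure R \x @lebesgue_measure R)%E.

Definition count_points (X : nat -> T -> R * R) (A : set (R * R)) (w : T) :
    \bar R :=
  (\sum_(0 <= i <oo) (\1_A (X i w))%:E)%E.

Definition homogeneous_poisson_process (lambda : R) (X : nat -> T -> R * R) :
    Prop :=
  (forall A : set (R * R), measurable A -> (area A < +oo)%E ->
     poisson_distributed (count_points X A) (lambda * fine (area A))) /\
  (forall (n : nat) (A : 'I_n -> set (R * R)),
     (forall i, measurable (A i)) -> (forall i, (area (A i) < +oo)%E) ->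
     trivIset setT A ->
     mutually_independent P (fun i => count_points X (A i))).

End poisson_process.

Section sinr.
Context (R : realType).

(* The library norm on [R * R] is the maximum norm. *)
Definition euclidean_norm (x : R * R) : R := Num.sqrt (x.1 ^+ 2 + x.2 ^+ 2).

Definition propagation_loss (K beta : R) (x : R * R) (s : R) : R :=
  (K * euclidean_norm x) `^ beta / s.

Context (T : Type) (K beta N : R) (X : nat -> T -> R * R) (S : nat -> T -> R).

Definition loss (i : nat) (w : T) : \bar R :=
  (propagation_loss K beta (X i w) (S i w))%:E.

Definition path_loss_factor (w : T) : \bar R :=
  ereal_inf (range (loss^~ w)).

(* Extended-real arithmetic, with [0^-1 = +oo], so that no convergence has to
   be assumed for the infinite sum. *)
Definition SINR (w : T) : \bar R :=
  let L := path_loss_factor w in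
  (L^-1 / (N%:E + (\sum_(0 <= i <oo) (loss i w)^-1 - L^-1)))%E.

End sinr.

(* Main.v *)
Require Import Defs.
From HB Require Import structures.
From mathcomp Require Import all_boot all_order all_algebra.
From mathcomp Require Import finmap.
From mathcomp Require Import all_classical all_reals all_analysis.
From mathcomp Require Import measurable_realfun.
From mathcomp Require Import ring lra.

Set Implicit Arguments.
Unset Strict Implicit.
Unset Printing Implicit Defensive.

Import Order.TTheory GRing.Theory Num.Theory.
Import numFieldNormedType.Exports.

Local Open Scope classical_set_scope.
Local Open Scope ring_scope.

(* Write Y_i = S_i / (K |X_i|)^beta for the received powers and I for their sum.
   The Y_i form a Poisson process whose intensity measure gives mass
   a u^(-2/beta) to [u, oo); in particular it is not finite, but
   E exp (- z I) = exp (- a Gamma (1 - 2/beta) z^(2/beta)), so I is finite.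
   For t >= 1 at most one index satisfies Y_i >= t (N + I - Y_i), so that
   P (SINR >= t) is the sum of the probabilities of these events.  The reduced
   Mecke formula replaces I - Y_i by an independent copy of I, which gives
   E (a (t (N + I))^(-2/beta)); expressing y^(-2/beta) as a Gamma integral of
   exp (- y r^beta) and using the Laplace transform of I yields the formula.
   The Mecke formula itself is derived from Laplace functionals:
   differentiating them gives the moments of exp (- (I - Y_i)) on the event
   that Y_i lies in B, and moments determine measures on [0, 1]. *)

(** * Measurability of the SINR *)

(** The process is given as a numbered sequence of points, known only through the joint law of the
    counts of disjoint sets of finite area. Sums over all indices do not depend on the numbering,
    and their Laplace functionals are what these counts determine. The mass a u^(-2/beta) is an
    averaged disc area: a station with mark s delivers at least u exactly when its squared distance
    from the origin is positive and at most (s/u)^(2/beta) / K^2, so the law of S enters only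
    through E S^(2/beta). The variable exp (- (I - Y_i)) is preferred to I - Y_i because it is
    bounded and because its k-th power is exp (- k I) exp (k Y_i): a weight depending on Y_i alone
    times the Laplace integrand of I. Derivatives are taken along the steps 2^-n, for which the
    difference quotients increase, so that monotone convergence applies even where values are
    infinite. The intensity has infinite mass near 0, whereas the Mecke formula is proved for sets
    of finite mass; powers are therefore first cut off at 1/(n+1). The total power is handled as an
    extended real until its Laplace transform near 0 shows that it is finite almost surely. *)

Lemma measurable_invr (R : realType) : measurable_fun setT (@GRing.inv R).
Proof.
(* [powR] gives inverses of nonnegative numbers only, hence the passage through the square; at 0
   both sides vanish. *)
rewrite (_ : @GRing.inv R = fun x => x * (x ^+ 2) `^ (-1)).
  apply: measurable_funM => //; apply: measurableT_comp (measurable_powR _) _.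
  exact: measurable_funX.
apply/funext => x; rewrite powR_inv1 ?sqr_ge0//.
have [->|x0] := eqVneq x 0; first by rewrite invr0 mul0r.
by rewrite expr2 invfM mulVKf.
Qed.

Lemma measurable_inve (R : realType) : measurable_fun setT (@inve R).
Proof.
rewrite (_ : @inve R = fun x => if x \is a fin_num then
    (if x == 0%E then +oo%E else ((fine x)^-1)%:E)
  else if x == +oo%E then 0%E else -oo%E); last first.
  by apply/funext => -[r| |].
have meq (y : \bar R) : measurable_fun setT (fun x : \bar R => x == y).
  exact: measurable_fun_eqe.
apply: measurable_fun_ifT => //=.
- by apply: (measurable_fun_bool true); exact/emeasurable_fin_num.
- apply: measurable_fun_ifT => //=; apply/measurable_EFinP.
  by apply: measurableT_comp (@measurable_invr R) _; exact: fine_measurable.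
- exact: measurable_fun_ifT.
Qed.

(** Where the limits inferior and superior differ, [limn] is a default value, and the set where they
    agree is measurable. The generality serves the series of reciprocal losses, whose terms have no
    sign as long as the marks are merely measurable. *)
Lemma measurable_limn d (T : measurableType d) (R : realType)
    (f : (T -> \bar R)^nat) : (forall n, measurable_fun setT (f n)) ->
  measurable_fun setT (fun x => limn (f ^~ x)).
Proof.
move=> mf.
rewrite (_ : (fun _ => _) = fun x =>
    if limn_einf (f ^~ x) == limn_esup (f ^~ x) then limn_esup (f ^~ x)
    else point); last first.
  apply/funext => x; case: ifPn => [/eqP infsup|infsup].
    apply/cvg_lim => //; apply: (@squeeze_cvge _ _ _ _ (einfs (f ^~ x)) _ (esups (f ^~ x))).
    - apply: nearW => n; apply/andP; split.
        by apply: ereal_inf_lbound; exists n => /=.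
      by apply: ereal_sup_ubound; exists n => /=.
    - rewrite -infsup limn_einf_lim; exact: is_cvg_einfs.
    - rewrite limn_esup_lim; exact: is_cvg_esups.
  apply: dvgP => /cvg_ex[l]; move/eqP: infsup; apply: contra_not.
  by move=> /cvg_limn_einf_sup[-> ->].
apply: measurable_fun_ifT => //.
- apply: measurable_fun_eqe; last exact: measurable_fun_limn_esup.
  under eq_fun do rewrite -[limn_einf _]oppeK -limn_esupN.
  apply: measurableT_comp => //; apply: measurable_fun_limn_esup => n.
  exact: measurableT_comp.
- exact: measurable_fun_limn_esup.
Qed.

Lemma measurable_euclidean_norm (R : realType) :
  measurable_fun setT (@euclidean_norm R).
Proof.
rewrite (_ : @euclidean_norm R = Num.sqrt \o (fun x => x.1 ^+ 2 + x.2 ^+ 2))//.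
have ms : measurable_fun setT (Num.sqrt : R -> R).
  apply: continuous_measurable_fun; exact: sqrt_continuous.
apply: measurableT_comp ms _.
by apply: measurable_funD; apply: measurable_funX.
Qed.

Lemma measurable_SINR d (T : measurableType d) (R : realType) (K beta N : R)
    (X : nat -> T -> R * R) (S : nat -> T -> R) :
  (forall i, measurable_fun setT (X i)) -> (forall i, measurable_fun setT (S i)) ->
  measurable_fun setT (SINR K beta N X S).
Proof.
move=> mX mS.
have mL i : measurable_fun setT (loss K beta X S i).
  apply/measurable_EFinP; apply: measurable_funM; last first.
    by apply: measurableT_comp (@measurable_invr R) _.
  apply: measurableT_comp (measurable_powR _) _; apply: measurable_funM => //.
  exact: measurableT_comp (@measurable_euclidean_norm R) (mX i).
have minv (g : T -> \bar R) : measurable_fun setT g -> measurable_fun setT (fun w => (g w)^-1%E).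
  exact: measurableT_comp (@measurable_inve R).
have mI : measurable_fun setT (path_loss_factor K beta X S).
  rewrite (_ : path_loss_factor _ _ _ _ = fun w => einfs (loss K beta X S ^~ w) 0).
    exact: measurable_fun_einfs.
  apply/funext => w; congr ereal_inf; apply/seteqP; split => [_ [i _ <-]|_ [i _ <-]].
    by exists i.
  by exists i.
apply: emeasurable_funM; first exact: minv.
apply: (minv (fun w => _ + (_ - _))%E); apply: emeasurable_funD => //; apply: emeasurable_funB; last exact: minv.
apply: measurable_limn => n; apply: emeasurable_sum => i; exact: minv.
Qed.

(** * Independence and Laplace functionals *)

Local Open Scope ereal_scope.

Lemma measurable_is_true d (T : measurableType d) (f : T -> bool) :
  measurable_fun setT f -> measurable [set x | f x].
Proof. by move=> /(_ measurableT [set true]); rewrite setTI; exact. Qed.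

Lemma measurable_layer d (T : measurableType d) (R : realType) (F : T -> R) :
  measurable_fun setT F ->
  measurable_fun setT (fun z : T * measurableTypeR R =>
    (\1_[set x | 0 <= z.2 < F x]%R z.1)%:E : \bar R).
Proof.
move=> mF.
rewrite (_ : (fun _ => _) = EFin \o \1_[set z : T * measurableTypeR R | (0 <= z.2 < F z.1)%R])//.
apply/measurable_EFinP; apply: measurable_indic.
have m2 : measurable_fun setT (snd : T * measurableTypeR R -> R) by exact: measurable_snd.
apply: measurable_is_true; apply: measurable_and; first exact: measurable_fun_ler.
by apply: measurable_fun_ltr => //; exact: measurableT_comp.
Qed.

(** Tonelli applied to F w = int 1{0 <= u < F w} du. It lets a product formula known for indicators
    pass to nonnegative functions, one factor at a time. *)
Lemma layer_cake d (T : measurableType d) (R : realType)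
    (mu : {sigma_finite_measure set T -> \bar R}) (F : T -> R) (H : T -> \bar R) :
  measurable_fun setT F -> (forall w, (0 <= F w)%R) ->
  measurable_fun setT H -> (forall w, 0 <= H w) ->
  \int[mu]_w ((F w)%:E * H w) = \int[lebesgue_measure]_u
    \int[mu]_w ((\1_[set x | 0 <= u < F x]%R w)%:E * H w).
Proof.
move=> mF F0 mH H0.
pose g (z : T * measurableTypeR R) : \bar R := (\1_[set x | 0 <= z.2 < F x]%R z.1)%:E * H z.1.
have mg : measurable_fun setT g.
  by apply: emeasurable_funM; [exact: measurable_layer|exact: measurableT_comp].
have g0 z : 0 <= g z by rewrite mule_ge0// lee_fin.
transitivity (\int[mu]_w \int[lebesgue_measure]_u g (w, u)); last exact: (fubini_tonelli g mg g0).
apply: eq_integral => w _; rewrite /g /=.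
rewrite ge0_integralZr//; last first.
  apply/measurable_EFinP.
  rewrite (_ : (fun _ => _) = \1_`[0%R, F w[%classic).
    exact: measurable_indic.
  by apply/funext => u; rewrite !indicE; congr (_%:R); apply/idP/idP; rewrite !inE /= in_itv.
congr (_ * _).
rewrite (_ : (fun _ => _) = EFin \o \1_`[0%R, F w[%classic); last first.
  apply/funext => u /=; rewrite !indicE; congr (_%:R%:E); apply/idP/idP; by rewrite !inE /= in_itv.
rewrite integral_indic//= setIT lebesgue_measure_itv/= lte_fin; case: ltP => h.
  by rewrite sube0.
congr EFin; apply/eqP; by rewrite eq_le F0 h.
Qed.

Section independence.
Context d (T : measurableType d) (R : realType) (P : probability T R).

Lemma mutually_independent_seq d' (T' : measurableType d') (I : choiceType)
    (Y : I -> T -> T') (s : seq I) (B : I -> set T') :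
  mutually_independent P Y -> uniq s -> (forall i, measurable (B i)) ->
  P (\bigcap_(i in [set` s]) (Y i @^-1` B i)) =
  \big[*%E/1]_(i <- s) P (Y i @^-1` B i).
Proof.
move=> indY us mB.
have := indY [fset i in s]%fset B mB.
rewrite (perm_big s) /=; last first.
  by apply: uniq_perm => // i; rewrite inE.
move=> <-; congr (P _); apply: eq_bigcapl.
by split => i /=; rewrite inE.
Qed.

Let prod_ge0 (I : Type) (s : seq I) (f : I -> R) : (forall i, 0 <= f i)%R ->
  0 <= \big[*%E/1]_(i <- s) (f i)%:E.
Proof.
by move=> f0; elim/big_ind: _ => // [x y x0 y0|i _]; [exact: mule_ge0|rewrite lee_fin].
Qed.

Lemma integral_prod_mutually_independent d' (T' : measurableType d')
    (I : choiceType) (Y : I -> T -> T') (s : seq I) (f : I -> T' -> R) :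
  mutually_independent P Y -> (forall i, measurable_fun setT (Y i)) -> uniq s ->
  (forall i, measurable_fun setT (f i)) -> (forall i y, (0 <= f i y)%R) ->
  \int[P]_w \big[*%E/1]_(i <- s) (f i (Y i w))%:E =
  \big[*%E/1]_(i <- s) \int[P]_w (f i (Y i w))%:E.
Proof.
move=> indY mY us mf f0.
have mYf (h : I -> T' -> R) : (forall i, measurable_fun setT (h i)) ->
    forall i, measurable_fun setT (fun w => (h i (Y i w))%:E).
  by move=> mh i; apply/measurable_EFinP; exact: measurableT_comp.
have mprod (h : I -> T' -> R) r : (forall i, measurable_fun setT (h i)) ->
    measurable_fun setT (fun w => \big[*%E/1]_(i <- r) (h i (Y i w))%:E).
  move=> mh; elim: r => [|i r ih].
    by under eq_fun do rewrite big_nil; exact: measurable_cst.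
  under eq_fun do rewrite big_cons.
  by apply: emeasurable_funM => //; exact: mYf.
(* The factors are turned into indicators one by one: those over [s2] already are, and the layer
   cake formula moves the head of [s1] to [s2]. Once [s1] is empty, the definition of independence
   concludes. *)
suff : forall s1 s2, uniq (s1 ++ s2) -> forall h : I -> T' -> R,
    (forall i, measurable_fun setT (h i)) -> (forall i y, (0 <= h i y)%R) ->
    (forall i, i \in s2 -> exists2 B, measurable B & h i = \1_B) ->
    \int[P]_w \big[*%E/1]_(i <- s1 ++ s2) (h i (Y i w))%:E =
    \big[*%E/1]_(i <- s1 ++ s2) \int[P]_w (h i (Y i w))%:E.
  by move/(_ s [::]); rewrite cats0; apply.
elim=> [|k s1 ih] s2 us12 h mh h0 hB.
  (* The preimage of 1 recovers the set behind an indicator, and is measurable for the indices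
     outside [s2] as well. *)
  rewrite /=; pose B i := h i @^-1` [set 1%R].
  have mB i : measurable (B i) by rewrite -[B i]setTI; exact: mh.
  have hBE i : i \in s2 -> h i = \1_(B i).
    move=> /hB[A mA hA]; rewrite hA; congr indic; apply/seteqP; rewrite /B hA.
    split => y /=; first by move=> Ay; rewrite indicE mem_set.
    by rewrite indicE; case: (boolP (y \in A)) => [/set_mem//|_] /esym/eqP; rewrite oner_eq0.
  transitivity (P (\bigcap_(i in [set` s2]) (Y i @^-1` B i))).
    rewrite -[X in P X]setIT -integral_indic//; last first.
      rewrite bigcap_seq; apply: bigsetI_measurable => i _.
      by rewrite -[X in measurable X]setTI; exact: mY.
    apply: eq_integral => w _; transitivity (\big[*%E/1]_(i <- s2) ((\1_(B i) : _ -> R) (Y i w))%:E).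
      by apply: eq_big_seq => i /hBE ->.
    rewrite bigcap_seq; elim: s2 {us12 hB hBE} => [|i r ih2].
      by rewrite !big_nil indicT.
    by rewrite !big_cons indicI/= EFinM ih2.
  rewrite mutually_independent_seq//; apply: eq_big_seq => i /hBE ->.
  rewrite -[X in P X]setIT -integral_indic// -[X in measurable X]setTI; exact: mY.
have [ks12 u12] : k \notin s1 ++ s2 /\ uniq (s1 ++ s2) by move: us12; rewrite /= => /andP.
have permk : perm_eq ((k :: s1) ++ s2) (s1 ++ (k :: s2)).
  by rewrite perm_sym -cat1s perm_catCA.
(* At height u the factor of [k] becomes the indicator of a level set, so the induction hypothesis
   applies with [k] counted in [s2]. *)
pose hu (u : R) := fun i => if i == k then \1_[set y | 0 <= u < h k y]%R else h i.
have huk u : hu u k = \1_[set y | 0 <= u < h k y]%R by rewrite /hu eqxx.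
have huE u i : i \in s1 ++ s2 -> hu u i = h i.
  by move=> is12; rewrite /hu; case: eqP is12 ks12 => // -> ->.
have mk u : measurable [set y | 0 <= u < h k y]%R.
  apply: measurable_is_true; apply: measurable_and => //; first exact: measurable_fun_ltr.
have mhu u i : measurable_fun setT (hu u i).
  by rewrite /hu; case: ifP => // _; exact: measurable_indic.
have IH u : \int[P]_w \big[*%E/1]_(i <- s1 ++ (k :: s2)) (hu u i (Y i w))%:E =
    \big[*%E/1]_(i <- s1 ++ (k :: s2)) \int[P]_w (hu u i (Y i w))%:E.
  apply: ih; rewrite -?(perm_uniq permk)//.
  - by move=> i y; rewrite /hu; case: ifP.
  - move=> i; rewrite inE => /predU1P[->|is2]; first by exists [set y | 0 <= u < h k y]%R.
    by rewrite huE ?mem_cat ?is2 ?orbT//; exact: hB.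
have LC (H : T -> \bar R) : measurable_fun setT H -> (forall w, 0 <= H w) ->
    \int[P]_w ((h k (Y k w))%:E * H w) =
    \int[lebesgue_measure]_u \int[P]_w ((hu u k (Y k w))%:E * H w).
  move=> mH H0.
  have mhY : measurable_fun setT (h k \o Y k) by exact: measurableT_comp.
  have hY0 w : (0 <= (h k \o Y k) w)%R by exact: h0.
  have := layer_cake P mhY hY0 mH H0.
  move=> /= ->.
  by apply: eq_integral => u _; apply: eq_integral => w _; rewrite huk !indicE.
rewrite /= big_cons; under eq_integral do rewrite big_cons.
rewrite LC//; last first.
- by move=> w; exact: prod_ge0.
- exact: mprod.
transitivity (\int[lebesgue_measure]_u ((\int[P]_w (hu u k (Y k w))%:E) *
    \big[*%E/1]_(i <- s1 ++ s2) \int[P]_w (h i (Y i w))%:E)).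
  apply: eq_integral => u _.
  transitivity (\int[P]_w \big[*%E/1]_(i <- s1 ++ (k :: s2)) (hu u i (Y i w))%:E).
    apply: eq_integral => w _; rewrite -(perm_big _ permk)/= big_cons; congr (_ * _).
    by apply: eq_big_seq => i is12; rewrite huE.
  rewrite IH -(perm_big _ permk)/= big_cons; congr (_ * _).
  by apply: eq_big_seq => i is12; rewrite huE.
rewrite ge0_integralZr//; last first.
- elim/big_ind: _ => // [x y x0 y0|i _]; [exact: mule_ge0|apply: integral_ge0 => w _; by rewrite lee_fin].
- by move=> u _; apply: integral_ge0 => w _; rewrite lee_fin huk.
- have := @measurable_fun_fubini_tonelli_G _ _ _ _ _ P _ (measurable_layer (measurableT_comp (mh k) (mY k))).
  rewrite [X in _ -> measurable_fun _ X](_ : _ = fubini_G P (fun z : T * measurableTypeR R =>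
      (\1_[set x | 0 <= z.2 < (h k \o Y k) x] z.1)%:E)).
    by apply => z; rewrite lee_fin.
  by apply/funext => u; apply: eq_integral => w _; rewrite huk !indicE.
congr (_ * _).
transitivity (\int[P]_w ((h k (Y k w))%:E * cst 1 w)); last first.
  by apply: eq_integral => w _; rewrite mule1.
rewrite (LC _ (measurable_cst _) (fun=> lee01)).
by apply: eq_integral => u _; apply: eq_integral => w _; rewrite mule1.
Qed.

Section independent_families.
Context d1 (T1 : measurableType d1) d2 (T2 : measurableType d2) (I : choiceType).
Variables (Y : I -> T -> T1) (Z : I -> T -> T2).
Hypothesis mY : forall i, measurable_fun setT (Y i).
Hypothesis mZ : forall i, measurable_fun setT (Z i).
Hypothesis YZ : independent_families P Y Z.

Let GY := \bigcup_i preimage_set_system setT (Y i) measurable.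
Let GZ := \bigcup_i preimage_set_system setT (Z i) measurable.
Let TY := g_sigma_algebraType GY.
Let TZ := g_sigma_algebraType GZ.

Let sub_family d3 (T3 : measurableType d3) (U : I -> T -> T3) :
  (forall i, measurable_fun setT (U i)) ->
  <<s \bigcup_i preimage_set_system setT (U i) measurable >> `<=` @measurable _ T.
Proof.
move=> mU; apply: smallest_sub; first exact: sigma_algebra_measurable.
by move=> A [i _ [B mB <-]]; exact: mU.
Qed.

Let mfamily d3 (T3 : measurableType d3) (U : I -> T -> T3) i :
  measurable_fun setT (U i :
    g_sigma_algebraType (\bigcup_i preimage_set_system setT (U i) measurable) -> T3).
Proof.
move=> _ B mB; apply: sub_sigma_algebra; exists i => //; exists B => //.
Qed.

Let idY (w : T) : TY := w.
Let idZ (w : T) : TZ := w.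

Let midY : measurable_fun setT idY.
Proof. by move=> _ A mA; rewrite setTI; exact: sub_family mA. Qed.

Let midZ : measurable_fun setT idZ.
Proof. by move=> _ A mA; rewrite setTI; exact: sub_family mA. Qed.

HB.instance Definition _ := isMeasurableFun.Build _ _ _ _ idY midY.
HB.instance Definition _ := isMeasurableFun.Build _ _ _ _ idZ midZ.

Let diag (w : T) : TY * TZ := (w, w).

Let mdiag : measurable_fun setT diag.
Proof. exact: measurable_fun_pair midY midZ. Qed.

HB.instance Definition _ := isMeasurableFun.Build _ _ _ _ diag mdiag.

(** [TY] and [TZ] are the set [T] with the two generated sigma-algebras. Independence says that the
    diagonal map into [TY * TZ] has the product of the laws of the two identity maps as its law;
    Tonelli then decouples the two arguments. *)
Lemma integral_independent_families (G : T -> T -> \bar R) :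
  @measurable_fun _ _ (TY * TZ)%type (\bar R) setT (fun z => G z.1 z.2) ->
  (forall w w', 0 <= G w w') ->
  \int[P]_w G w w = \int[P]_w \int[P]_w' G w w'.
Proof.
move=> mG G0.
have E : forall C : set (TY * TZ), measurable C ->
  (distribution P idY \x distribution P idZ) C = distribution P diag C.
  apply: product_measure_unique => A B mA mB.
  by rewrite /distribution /pushforward /=; exact: YZ.
transitivity (\int[distribution P diag]_z G z.1 z.2).
  by rewrite ge0_integral_distribution.
transitivity (\int[distribution P idY \x distribution P idZ]_z G z.1 z.2).
  by apply: eq_measure_integral => A mA _; first [exact: E|exact/esym/E].
rewrite fubini_tonelli1// ge0_integral_distribution//; last first.
- by move=> w; apply: integral_ge0 => w' _; exact: G0.
- by apply: measurable_fun_fubini_tonelli_F => // z; exact: G0.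
apply: eq_integral => w _; rewrite /= /fubini_F ge0_integral_distribution//=.
  exact: (measurable_fun_pair2 (f := fun z : TY * TZ => G z.1 z.2)).
Qed.

(** Once the locations are frozen by the decoupling, the marks are independent with the law of [S],
    so each factor is averaged over its own mark. *)
Lemma integral_prod_marks (S : T -> T2) (s : seq I) (g : T1 * T2 -> R) :
  mutually_independent P Z -> uniq s -> measurable_fun setT S ->
  (forall i B, measurable B -> P (Z i @^-1` B) = P (S @^-1` B)) ->
  measurable_fun setT g -> (forall z, (0 <= g z)%R) ->
  \int[P]_w \big[*%E/1]_(i <- s) (g (Y i w, Z i w))%:E =
  \int[P]_w \big[*%E/1]_(i <- s) \int[P]_w' (g (Y i w, S w'))%:E.
Proof.
move=> indZ us mS lawZ mg g0.
rewrite (@integral_independent_families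
  (fun w w' => \big[*%E/1]_(i <- s) (g (Y i w, Z i w'))%:E)); last 2 first.
- elim: s us => [_|i r ih /andP[_ /ih mr]].
    by under eq_fun do rewrite big_nil; exact: measurable_cst.
  under eq_fun do rewrite big_cons.
  apply: emeasurable_funM => //; apply/measurable_EFinP.
  apply: measurableT_comp mg _; apply: measurable_fun_pair.
    exact: measurableT_comp (mfamily _) measurable_fst.
  exact: measurableT_comp (mfamily _) measurable_snd.
- by move=> w w'; exact: prod_ge0.
apply: eq_integral => w _.
have mgY i : measurable_fun setT (fun y => g (Y i w, y)) by exact: measurable_fun_pair2.
rewrite (@integral_prod_mutually_independent _ _ _ Z s (fun i y => g (Y i w, y)))//.
apply: eq_bigr => i _.
rewrite -(@ge0_integral_pushforward _ _ _ _ _ _ (mZ i) P setT (fun y => (g (Y i w, y))%:E))//; last first.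
- by move=> y _; rewrite lee_fin.
- exact/measurable_EFinP.
rewrite -(@ge0_integral_pushforward _ _ _ _ _ _ mS P setT (fun y => (g (Y i w, y))%:E))//; last first.
- by move=> y _; rewrite lee_fin.
- exact/measurable_EFinP.
by apply: eq_measure_integral => A mA _; rewrite /pushforward; first [exact: lawZ|rewrite lawZ].
Qed.
End independent_families.

End independence.

Lemma nneseries_exp_coeff (R : realType) (x : R) : (0 <= x)%R ->
  \sum_(k <oo) (x ^+ k / k`!%:R)%:E = (expR x)%:E.
Proof.
move=> x0; rewrite expRE -EFin_lim; last first.
  rewrite /pseries/=; under eq_fun do rewrite mulrC.
  exact: is_cvg_series_exp_coeff.
apply/congr_lim/funext => n/=; rewrite /pseries/= /series/= -sumEFin//.
by under eq_bigr do rewrite mulrC.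
Qed.

Lemma bounded_cvg_integral d (T : measurableType d) (R : realType)
    (mu : {finite_measure set T -> \bar R}) (f_ : (T -> \bar R)^nat)
    (f : T -> \bar R) (M : R) :
  (forall n, measurable_fun setT (f_ n)) -> measurable_fun setT f ->
  {ae mu, forall w, f_ n w @[n --> \oo] --> f w} ->
  {ae mu, forall w n, `|f_ n w| <= M%:E} ->
  \int[mu]_w f_ n w @[n --> \oo] --> \int[mu]_w f w.
Proof.
move=> mf_ mf f_f f_M.
have f_f' : {ae mu, forall w, setT w -> f_ n w @[n --> \oo] --> f w}.
  by apply: filterS f_f.
have f_M' : {ae mu, forall w n, setT w -> `|f_ n w| <= cst M%:E w}.
  by apply: filterS f_M => w h n _; exact: h.
have iM : mu.-integrable setT (cst M%:E) by exact: finite_measure_integrable_cst.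
by have [] := dominated_convergence measurableT mf_ mf f_f' iM f_M'.
Qed.

Lemma integral_gt0 d (T : measurableType d) (R : realType)
    (mu : {measure set T -> \bar R}) (f : T -> \bar R) :
  0 < mu setT -> measurable_fun setT f -> (forall w, 0 <= f w) ->
  {ae mu, forall w, 0 < f w} -> 0 < \int[mu]_w f w.
Proof.
move=> mu0 mf f0 f_gt0; rewrite lt0e integral_ge0 ?andbT//; apply/eqP => int0.
have : ae_eq mu setT f (cst 0).
  apply/ae_eq_integral_abs => //; rewrite -[RHS]int0.
  by apply: eq_integral => w _; rewrite gee0_abs.
move=> fE; have : {ae mu, forall w : T, False}.
  by apply: filterS2 f_gt0 fE => w /[swap] /(_ Logic.I) /= ->; rewrite ltxx.
move=> [N [mN muN0 subN]]; move: mu0; rewrite (_ : setT = N) ?muN0 ?ltxx//.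
by apply/seteqP; split => // w _; apply: subN => /=.
Qed.

Lemma measurable_expeRN (R : realType) : measurable_fun setT (fun x : \bar R => expeR (- x)).
Proof.
rewrite (_ : (fun _ => _) = fun x => if x \is a fin_num then (expR (- fine x))%:E
    else if x == +oo then 0 else +oo); last by apply/funext => -[].
apply: measurable_fun_ifT => //=.
- by apply: (measurable_fun_bool true); exact/emeasurable_fin_num.
- apply/measurable_EFinP; apply: measurableT_comp; first exact: measurable_expR.
  by apply: measurable_funN; exact: fine_measurable.
- by apply: measurable_fun_ifT => //; exact: measurable_fun_eqe.
Qed.

Lemma expeRN_le1 (R : realType) (x : \bar R) : 0 <= x -> expeR (- x) <= 1.
Proof. by move=> x0; rewrite -expeR0 lee_expeR leeNl oppe0. Qed.

Lemma expeRN_sum (R : realType) I (s : seq I) (u : I -> \bar R) :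
  (forall i, 0 <= u i) ->
  expeR (- \sum_(i <- s) u i) = \big[*%E/1]_(i <- s) expeR (- u i).
Proof.
move=> u0; elim: s => [|i s ih]; first by rewrite !big_nil oppe0 expeR0.
rewrite !big_cons oppeD ?expeRD ?ih//.
by rewrite ge0_adde_def// inE// sume_ge0.
Qed.

(** The limit l = +oo is included, so that it applies to sums not yet known to be finite. *)
Lemma cvg_expeRN (R : realType) (u : (\bar R)^nat) (l : \bar R) :
  u @ \oo --> l -> (forall n, 0 <= u n) ->
  (fun n => expeR (- u n)) @ \oo --> expeR (- l).
Proof.
move=> ul u0.
have l0 : 0 <= l by rewrite -(cvg_lim _ ul)//; apply: lime_ge; [apply/cvg_ex; exists l|exact: nearW].
case: l => [r| |] in ul l0 *; last by [].
  move/fine_cvgP : ul => [finu ur]; apply/fine_cvgP; split.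
    near=> n; have : u n \is a fin_num by near: n.
    by case: (u n).
  rewrite /=.
  have : expR (- fine (u n)) @[n --> \oo] --> expR (- r).
    by apply: (cvg_comp _ _ (cvgN ur)); exact: continuous_expR.
  apply: cvg_trans; apply: near_eq_cvg; near=> n => /=.
  have : u n \is a fin_num by near: n.
  by case: (u n).
rewrite /=.
apply/fine_cvgP; split.
   apply: nearW => n; have := u0 n; by case: (u n).
apply/cvgrPdist_le => /= e e0; near=> n.
have : (- ln e)%:E <= u n by near: n; move/cvgeyPge : ul; apply.
have := u0 n.
rewrite sub0r normrN; case: (u n) => //= [x|_ _]; last by rewrite normr0 ltW.
move=> _; rewrite lee_fin lerNl => h.
by rewrite ger0_norm ?expR_ge0// -[leRHS]lnK ?posrE// ler_expR.
Unshelve. all: by end_near. Qed.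

(** Monotone convergence for the counting measure. *)
Lemma cvg_nneseries_nd (R : realType) (u : nat -> (\bar R)^nat) (v : (\bar R)^nat) :
  (forall n i, 0 <= u n i) -> (forall i, nondecreasing_seq (u ^~ i)) ->
  (forall i, u n i @[n --> \oo] --> v i) ->
  \sum_(i <oo) u n i @[n --> \oo] --> \sum_(i <oo) v i.
Proof.
move=> u0 ndu uv.
have v0 i : 0 <= v i by rewrite -(cvg_lim _ (uv i))//; apply: lime_ge; [apply/cvg_ex; exists (v i)|exact: nearW].
rewrite -ge0_integral_count//.
under eq_fun do rewrite -ge0_integral_count//.
rewrite (_ : v = fun i => limn (u ^~ i)); last by apply/funext => i; apply/esym/cvg_lim.
by apply: cvg_monotone_convergence => // i _ m n mn; exact: ndu.
Qed.

(** * Laplace functionals of Poisson processes, without and with marks *)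

Section laplace_poisson.
Context d (T : measurableType d) (R : realType) (P : probability T R).

Lemma integral_poisson (N : T -> \bar R) (m c : R) : measurable_fun setT N ->
  (0 <= m)%R -> (0 <= c)%R -> poisson_distributed P N m ->
  \int[P]_w expeR (- (c%:E * N w)) = (expR (- (m * (1 - expR (- c)))))%:E.
Proof.
move=> mN m0 c0 poisN.
pose A (k : nat) := N @^-1` [set k%:R%:E].
have mA k : measurable (A k) by rewrite -[A k]setTI; exact: mN.
have tA : trivIset setT A.
  by move=> i j _ _ [w []]; rewrite /A /= => -> [] /eqP; rewrite eqr_nat => /eqP.
have mf : measurable_fun setT (fun w => expeR (- (c%:E * N w))).
  apply: measurableT_comp (@measurable_expeRN R) _; exact: emeasurable_funM.
(* Nothing forces [N] to take integer values, but the Poisson weights add up to 1, so all other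
   values form a null event. *)
have PA : P (\bigcup_k A k) = 1.
  rewrite measure_bigcup//.
  rewrite (@eq_eseriesl _ _ xpredT); last by move=> k; rewrite in_setT.
  transitivity (\sum_(k <oo) ((expR (- m))%:E * (m ^+ k / k`!%:R)%:E)).
    by apply: eq_eseriesr => k _; rewrite [LHS]poisN -EFinM mulrC.
  rewrite nneseriesZl ?nneseries_exp_coeff//; last first.
    by move=> k _; rewrite lee_fin divr_ge0// exprn_ge0.
  by rewrite -EFinM -expRD addNr expR0.
have mUA : measurable (\bigcup_k A k) by exact: bigcup_measurable.
have PCA : P (~` \bigcup_k A k) = 0 by rewrite probability_setC// PA subee.
rewrite (ge0_negligible_integral _ _ _ _ PCA)//=; last 2 first.
- exact: measurableC.
- by move=> w _; exact: expeR_ge0.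
rewrite setTD setCK ge0_integral_bigcup//; last 2 first.
- exact: measurable_funTS.
- by move=> w _; exact: expeR_ge0.
transitivity (\sum_(k <oo) ((expR (- m))%:E * ((m * expR (- c)) ^+ k / k`!%:R)%:E)).
  apply: eq_eseriesr => k _.
  transitivity (\int[P]_(w in A k) cst (expR (- c) ^+ k)%:E w).
    apply: eq_integral => w; rewrite inE => ->.
    by rewrite /= -expRM_natl mulrN mulrC.
  have PAk : P (A k) = (m ^+ k / k`!%:R * expR (- m))%:E by exact: poisN.
  rewrite integral_cst// [X in _ * X]PAk -!EFinM; congr EFin.
  by rewrite exprMn; ring.
rewrite nneseriesZl; last first.
  by move=> k _; rewrite lee_fin divr_ge0// exprn_ge0// mulr_ge0// expR_ge0.
rewrite nneseries_exp_coeff ?mulr_ge0 ?expR_ge0// -EFinM -expRD; congr (expR _)%:E; ring.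
Qed.

Section poisson_process.
Context d' (E : measurableType d') (mu : {sigma_finite_measure set E -> \bar R}).
Variables (X : nat -> T -> E) (lambda : R).
Hypothesis mX : forall i, measurable_fun setT (X i).
Hypothesis lambda0 : (0 <= lambda)%R.

Let N (A : set E) (w : T) : \bar R := \sum_(0 <= i <oo) (\1_A (X i w))%:E.

Hypothesis N_poisson : forall A, measurable A -> mu A < +oo ->
  poisson_distributed P (N A) (lambda * fine (mu A))%R.
Hypothesis N_indep : forall n (A : 'I_n -> set E), (forall i, measurable (A i)) ->
  (forall i, mu (A i) < +oo) -> trivIset setT A ->
  mutually_independent P (fun i => N (A i)).

Let mN A : measurable A -> measurable_fun setT (N A).
Proof.
move=> mA; apply: ge0_emeasurable_sum => // i _.
by apply/measurable_EFinP; apply: measurableT_comp (mX i); exact: measurable_indic.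
Qed.

Let N_ge0 A w : 0 <= N A w.
Proof. by apply: nneseries_ge0 => i _ _; rewrite lee_fin. Qed.

(** Exchanging the two sums turns the exponent into the combination of the counts [N (A k)] with
    coefficients [c k]; these are independent Poisson variables, so the transform factorizes. *)
Let laplace_indic n (A : 'I_n -> set E) (c : 'I_n -> R) :
  (forall i, measurable (A i)) -> (forall i, mu (A i) < +oo) ->
  trivIset setT A -> (forall i, (0 <= c i)%R) ->
  \int[P]_w expeR (- \sum_(i <oo) (\sum_(k < n) c k * \1_(A k) (X i w))%:E) =
  expeR (- (lambda%:E * \sum_(k < n) (1 - expR (- c k))%:E * mu (A k))).
Proof.
move=> mA Aoo tA c0.
pose f (k : 'I_n) (y : \bar R) : R := fine (expeR (- ((c k)%:E * y))).
have cN0 k w : 0 <= (c k)%:E * N (A k) w by rewrite mule_ge0// lee_fin.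
have fE k w : (f k (N (A k) w))%:E = expeR (- ((c k)%:E * N (A k) w)).
  by rewrite fineK// ge0_fin_numE ?expeR_ge0// (le_lt_trans (expeRN_le1 _))// ltry.
transitivity (\int[P]_w \big[*%E/1]_(k < n) (f k (N (A k) w))%:E).
  apply: eq_integral => w _.
  transitivity (expeR (- \sum_(k < n) (c k)%:E * N (A k) w)).
    congr (expeR (- _)); under eq_eseriesr do rewrite -sumEFin.
    rewrite nneseries_sum//; last by move=> k i _; rewrite lee_fin mulr_ge0.
    apply: eq_bigr => k _; rewrite -nneseriesZl//.
  rewrite expeRN_sum//; apply: eq_bigr => k _; exact/esym/fE.
have mf k : measurable_fun setT (f k).
  apply: measurableT_comp; first exact: fine_measurable.
  by apply: measurableT_comp (@measurable_expeRN R) _; exact: emeasurable_funM.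
have f0 k y : (0 <= f k y)%R by apply: fine_ge0; exact: expeR_ge0.
rewrite (integral_prod_mutually_independent (N_indep mA Aoo tA) _ (index_enum_uniq _) mf f0); last first.
  by move=> k; exact: mN.
transitivity (\big[*%E/1]_(k < n) expeR (- (lambda%:E * ((1 - expR (- c k))%:E * mu (A k))))).
  apply: eq_bigr => k _; under eq_integral do rewrite fE.
  rewrite (@integral_poisson _ (lambda * fine (mu (A k)))%R)//; last 3 first.
  - exact: mN.
  - by rewrite mulr_ge0// fine_ge0.
  - exact: N_poisson.
  have muE : mu (A k) = (fine (mu (A k)))%:E by rewrite fineK// ge0_fin_numE.
  rewrite [in RHS]muE -!EFinM /=.
  by congr (expR _)%:E; ring.
have cmu0 k : 0 <= (1 - expR (- c k))%:E * mu (A k).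
  by rewrite mule_ge0// lee_fin subr_ge0 -expR0 ler_expR lerNl oppr0.
rewrite ge0_sume_distrr// expeRN_sum// => k.
by rewrite mule_ge0.
Qed.

Import HBNNSimple.

Let laplace_nnsfun (f : {nnsfun E >-> R}) (F : set E) :
  measurable F -> mu F < +oo -> (forall x, ~ F x -> f x = 0%R) ->
  \int[P]_w expeR (- \sum_(i <oo) (f (X i w))%:E) =
  expeR (- (lambda%:E * \int[mu]_x (1 - expR (- f x))%:E)).
Proof.
move=> mF Foo f0.
(* The value 0 is left out: its level set may have infinite measure, whereas the other level sets
   lie in [F]. *)
pose s := [seq r <- fset_set (range f) | r != 0%R].
pose c (k : 'I_(size s)) : R := nth 0%R s k.
pose A (k : 'I_(size s)) := f @^-1` [set c k].
have us : uniq s by rewrite filter_uniq//; exact: fset_uniq.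
have cs k : c k \in s by exact: mem_nth.
have c_neq0 k : c k != 0%R by have := cs k; rewrite mem_filter => /andP[].
have cE k : exists x, f x = c k.
  have := cs k; rewrite mem_filter in_fset_set; last exact: fimfunP.
  by move=> /andP[_]; rewrite inE => -[x _ <-]; exists x.
have c0 k : (0 <= c k)%R by have [x <-] := cE k.
have mA k : measurable (A k) by rewrite -[A k]setTI; exact: measurable_funP.
have AF k : A k `<=` F.
  move=> x Ax; apply: contrapT => /f0 fx0; have := c_neq0 k.
  by rewrite -Ax fx0 eqxx.
have Aoo k : mu (A k) < +oo.
  by apply: le_lt_trans Foo; apply: le_measure; rewrite ?inE.
have tA : trivIset setT A.
  move=> i j _ _ [x []]; rewrite /A /= => -> /eqP.
  by rewrite /c nth_uniq// => /eqP/val_inj.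
(* Stated for every g vanishing at 0, in order to cover both f and 1 - exp (- f). *)
have gE (g : R -> R) x : g 0%R = 0%R -> g (f x) = (\sum_(k < size s) g (c k) * \1_(A k) x)%R.
  move=> g0.
  transitivity (\sum_(r <- s) g r * (f x == r)%:R)%R; last first.
    rewrite (big_nth 0%R) big_mkord; apply: eq_bigr => k _; congr (_ * _%:R)%R.
    by case: eqP => fxk; [rewrite mem_set|rewrite memNset].
  have [fx0|fx0] := eqVneq (f x) 0%R.
    rewrite fx0 g0 big_seq big1// => r; rewrite mem_filter eq_sym => /andP[/negPf -> _].
    by rewrite mulr0.
  have fxs : f x \in s.
    by rewrite mem_filter fx0 in_fset_set; [rewrite inE; exists x|exact: fimfunP].
  rewrite (bigD1_seq (f x))//= eqxx mulr1 big1 ?addr0// => r.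
  by rewrite eq_sym => /negPf ->; rewrite mulr0.
under eq_integral do under eq_eseriesr do rewrite (gE id)//.
rewrite laplace_indic//; congr (expeR (- (_ * _))).
under [in RHS]eq_integral do rewrite (gE (fun r => 1 - expR (- r))%R) ?oppr0 ?expR0 ?subrr// -sumEFin.
have e0 k : (0 <= 1 - expR (- c k))%R by rewrite subr_ge0 -expR0 ler_expR lerNl oppr0.
rewrite ge0_integral_sum//; last 2 first.
- move=> k; apply/measurable_EFinP; apply: measurable_funM => //; exact: measurable_indic.
- by move=> k x _; rewrite lee_fin mulr_ge0.
apply: eq_bigr => k _; under eq_integral do rewrite EFinM.
rewrite ge0_integralZl//; last 2 first.
- by apply/measurable_EFinP; exact: measurable_indic.
- by rewrite lee_fin.
by rewrite integral_indic// setIT.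
Qed.

Lemma laplace_poisson_process (f : E -> R) :
  measurable_fun setT f -> (forall x, (0 <= f x)%R) ->
  \int[P]_w expeR (- \sum_(i <oo) (f (X i w))%:E) =
  expeR (- (lambda%:E * \int[mu]_x (1 - expR (- f x))%:E)).
Proof.
move=> mf f0.
have /sigma_finiteP[F [FT ndF Foo]] := sigma_finiteT mu.
have mF n : measurable (F n) by have [] := Foo n.
have mEf : measurable_fun setT (EFin \o f) by exact/measurable_EFinP.
pose g n := nnsfun_approx measurableT mEf n.
(* Restricting to [F n] makes the support of finite measure and keeps the sequence increasing. The
   left side then converges by boundedness, the integral on the right monotonically. *)
pose h n : {nnsfun E >-> R} := mul_nnsfun (g n) (indic_nnsfun R (mF n)).
have hE n x : h n x = (g n x * \1_(F n) x)%R by [].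
have ndh x : nondecreasing_seq (h ^~ x).
  move=> m n mn; rewrite !hE ler_pM//; first exact/lefP/nd_nnsfun_approx.
  rewrite !indicE ler_nat; have [Fm|//] := boolP (x \in F m).
  by rewrite mem_set//; move: Fm; rewrite inE; exact/subsetPset/ndF.
have cvgh x : (h n x)%:E @[n --> \oo] --> (f x)%:E.
  have [k _ Fkx] : (\bigcup_i F i) x by rewrite -FT.
  have : (g n x)%:E @[n --> \oo] --> (f x)%:E.
    by apply: cvg_nnsfun_approx => // y _; rewrite lee_fin.
  apply: cvg_trans; apply: near_eq_cvg; near=> n.
  rewrite hE indicE mem_set ?mulr1//.
  have kn : (k <= n)%N by near: n; exists k.
  by move: Fkx; apply/subsetPset/ndF.
have h0 n x : (0 <= h n x)%R by [].
have mS (u : E -> R) : measurable_fun setT u -> (forall x, (0 <= u x)%R) ->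
    measurable_fun setT (fun w => expeR (- \sum_(i <oo) (u (X i w))%:E)).
  move=> mu' u0; apply: measurableT_comp (@measurable_expeRN R) _.
  apply: ge0_emeasurable_sum => [i w _ _|i _]; first by rewrite lee_fin.
  by apply/measurable_EFinP; exact: measurableT_comp (mX i).
have sum_ge0 (u : E -> R) w : (forall x, (0 <= u x)%R) -> 0 <= \sum_(i <oo) (u (X i w))%:E.
  by move=> u0; apply: nneseries_ge0 => i _ _; rewrite lee_fin.
have cvgl : \int[P]_w expeR (- \sum_(i <oo) (h n (X i w))%:E) @[n --> \oo] -->
    \int[P]_w expeR (- \sum_(i <oo) (f (X i w))%:E).
  apply: (@bounded_cvg_integral _ _ _ _ _ _ 1).
  - by move=> n; exact: mS (measurable_funP (h n)) _.
  - exact: mS.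
  - apply: aeW => w; apply: cvg_expeRN => [|n]; last exact: sum_ge0.
    apply: cvg_nneseries_nd => //.
    + by move=> n i; rewrite lee_fin.
    + by move=> i m n mn; rewrite lee_fin; exact: ndh.
  - apply: aeW => w n; rewrite gee0_abs ?expeR_ge0//.
    by apply: expeRN_le1; exact: sum_ge0.
have cvgr : \int[mu]_x (1 - expR (- h n x))%:E @[n --> \oo] -->
    \int[mu]_x (1 - expR (- f x))%:E.
  have e0 (u : E -> R) x : (0 <= u x)%R -> 0 <= (1 - expR (- u x))%:E.
    by rewrite lee_fin subr_ge0 -expR0 ler_expR lerNl oppr0.
  rewrite (_ : (fun x => (1 - expR (- f x))%:E) = fun x => limn (fun n => (1 - expR (- h n x))%:E)).
    apply: cvg_monotone_convergence => //.
    - move=> n; apply/measurable_EFinP; apply: measurable_funB => //.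
      apply: measurableT_comp; first exact: measurable_expR.
      exact: measurable_funN.
    - by move=> n x _; exact: e0.
    - by move=> x _ m n mn; rewrite lee_fin lerB// ler_expR lerN2; exact: ndh.
  apply/funext => x; apply/esym/cvg_lim => //.
  apply: cvg_EFin; first exact: nearW.
  rewrite /=; apply: cvgB; first exact: cvg_cst.
  have /fine_cvg hf := cvgh x.
  by apply: (cvg_comp _ _ (cvgN hf)); exact: continuous_expR.
have : expeR (- (lambda%:E * \int[mu]_x (1 - expR (- h n x))%:E)) @[n --> \oo] -->
    expeR (- (lambda%:E * \int[mu]_x (1 - expR (- f x))%:E)).
  apply: cvg_expeRN => [|n]; first exact: cvgeZl.
  rewrite mule_ge0//; apply: integral_ge0 => x _.
  by rewrite lee_fin subr_ge0 -expR0 ler_expR lerNl oppr0.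
have lE n : expeR (- (lambda%:E * \int[mu]_x (1 - expR (- h n x))%:E)) =
    \int[P]_w expeR (- \sum_(i <oo) (h n (X i w))%:E).
  rewrite (laplace_nnsfun (mF n) (Foo n).2)// => x Fx.
  by rewrite hE indicE memNset// mulr0.
under eq_fun do rewrite lE.
exact: cvg_unique cvgl.
Unshelve. all: by end_near. Qed.

(** Averaging over the marks replaces exp (- h (x, .)) by phi x = E exp (- h (x, S)). With f = - ln
    phi, which is nonnegative, the marked sum of h has the same Laplace transform as the unmarked
    sum of f, and 1 - exp (- f x) = E (1 - exp (- h (x, S))). *)
Lemma laplace_marked_poisson_process d2 (T2 : measurableType d2)
    (Z : nat -> T -> T2) (S : T -> T2) (h : E * T2 -> R) :
  (forall i, measurable_fun setT (Z i)) -> measurable_fun setT S ->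
  (forall i B, measurable B -> P (Z i @^-1` B) = P (S @^-1` B)) ->
  mutually_independent P Z -> independent_families P X Z ->
  measurable_fun setT h -> (forall z, (0 <= h z)%R) ->
  \int[P]_w expeR (- \sum_(i <oo) (h (X i w, Z i w))%:E) =
  expeR (- (lambda%:E * \int[mu]_x \int[P]_w (1 - expR (- h (x, S w)))%:E)).
Proof.
move=> mZ mS lawZ indZ indXZ mh h0.
pose e z := expR (- h z).
have me : measurable_fun setT e.
  by apply: measurableT_comp; [exact: measurable_expR|exact: measurable_funN].
have e0 z : (0 <= e z)%R by exact: expR_ge0.
have e1 z : (e z <= 1)%R by rewrite -expR0 ler_expR lerNl oppr0.
have meS x : measurable_fun setT (fun w => e (x, S w)).
  by apply: measurableT_comp me _; exact: measurable_fun_pair.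
have mEeS x : measurable_fun setT (fun w => (e (x, S w))%:E) by exact/measurable_EFinP.
have int1 x : \int[P]_w (e (x, S w))%:E <= 1.
  rewrite -[leRHS](@probability_setT _ _ _ P) -[leRHS]mul1e -integral_cst//.
  by apply: ge0_le_integral => // w _; rewrite lee_fin.
have int0 x : 0 < \int[P]_w (e (x, S w))%:E.
  apply: integral_gt0 => //.
    by rewrite [ltRHS](@probability_setT _ _ _ P) lte01.
    by move=> w; rewrite lee_fin.
  by apply: aeW => w; rewrite lte_fin expR_gt0.
pose phi x : R := fine (\int[P]_w (e (x, S w))%:E).
have phiE x : (phi x)%:E = \int[P]_w (e (x, S w))%:E.
  by rewrite fineK// ge0_fin_numE ?ltW// (le_lt_trans (int1 x))// ltry.
have phi0 x : (0 < phi x)%R by rewrite -lte_fin phiE.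
have phi1 x : (phi x <= 1)%R by rewrite -lee_fin phiE.
have mphi : measurable_fun setT phi.
  apply: measurableT_comp; first exact: fine_measurable.
  have := @measurable_fun_fubini_tonelli_F _ _ E T R P (fun z => (e (z.1, S z.2))%:E).
  apply => //; last by move=> z; rewrite lee_fin.
  apply/measurable_EFinP; apply: measurableT_comp me _.
  by apply: measurable_fun_pair => //; exact: measurableT_comp.
pose f x := (- ln (phi x))%R.
have mf : measurable_fun setT f.
  by apply: measurable_funN; apply: measurableT_comp => //; exact: measurable_ln.
have f0 x : (0 <= f x)%R by rewrite oppr_ge0 ln_le0.
have expf x : expR (- f x) = phi x by rewrite opprK lnK ?posrE.
(* The marks can be averaged out of finite products; bounded convergence carries the identity over
   to the infinite sum. *)
have prod_lim (u : nat -> T -> R) : (forall i, measurable_fun setT (u i)) ->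
    (forall i w, (0 <= u i w)%R) ->
    \int[P]_w \big[*%E/1]_(i <- iota 0 n) (expR (- u i w))%:E @[n --> \oo] -->
    \int[P]_w expeR (- \sum_(i <oo) (u i w)%:E).
  move=> mu' u0; have uE n w : \big[*%E/1]_(i <- iota 0 n) (expR (- u i w))%:E =
      expeR (- \sum_(0 <= i < n) (u i w)%:E).
    rewrite -[n in iota 0 n]subn0 expeRN_sum//.
    by move=> i; rewrite lee_fin.
  under eq_fun do under eq_integral do rewrite uE.
  have sum0 n w : 0 <= \sum_(0 <= i < n) (u i w)%:E by apply: sume_ge0 => i _; rewrite lee_fin.
  apply: (@bounded_cvg_integral _ _ _ _ _ _ 1).
  - move=> n; apply: measurableT_comp (@measurable_expeRN R) _.
    by apply: emeasurable_sum => i; exact/measurable_EFinP.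
  - apply: measurableT_comp (@measurable_expeRN R) _.
    apply: ge0_emeasurable_sum => [i w _ _|i _]; first by rewrite lee_fin.
    exact/measurable_EFinP.
  - apply: aeW => w; apply: cvg_expeRN => //.
    by apply: is_cvg_nneseries => i _ _; rewrite lee_fin.
  - by apply: aeW => w n; rewrite gee0_abs ?expeR_ge0// expeRN_le1.
have eqn n : \int[P]_w \big[*%E/1]_(i <- iota 0 n) (e (X i w, Z i w))%:E =
    \int[P]_w \big[*%E/1]_(i <- iota 0 n) (expR (- f (X i w)))%:E.
  rewrite (integral_prod_marks mX mZ indXZ indZ (iota_uniq 0 n) mS lawZ me e0).
  by apply: eq_integral => w _; apply: eq_bigr => i _; rewrite expf phiE.
have l1 := prod_lim _ (fun i => measurableT_comp mf (mX i)) (fun i w => f0 (X i w)).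
have l2 := prod_lim _ (fun i => measurableT_comp mh (measurable_fun_pair (mX i) (mZ i)))
  (fun i w => h0 (X i w, Z i w)).
have {}l1 : \int[P]_w \big[*%E/1]_(i <- iota 0 n) (e (X i w, Z i w))%:E @[n --> \oo] -->
    \int[P]_w expeR (- \sum_(i <oo) (f (X i w))%:E).
  by under eq_fun do rewrite eqn.
transitivity (\int[P]_w expeR (- \sum_(i <oo) (f (X i w))%:E)).
  exact: cvg_unique l2 l1.
rewrite laplace_poisson_process//; congr (expeR (- (_ * _))).
apply: eq_integral => x _; rewrite expf EFinB phiE.
have <- : \int[P]_w (1 - e (x, S w))%:E + \int[P]_w (e (x, S w))%:E = 1.
  rewrite -ge0_integralD//; last 3 first.
  - by move=> w _; rewrite lee_fin subr_ge0.
  - by apply/measurable_EFinP; apply: measurable_funB.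
  - by move=> w _; rewrite lee_fin.
  rewrite -[RHS](@probability_setT _ _ _ P) -[RHS]mul1e -integral_cst//.
  by apply: eq_integral => w _; rewrite -EFinD subrK.
by rewrite addeK// -phiE.
Qed.

End poisson_process.

End laplace_poisson.

Local Close Scope ereal_scope.

(** * Measures on [0, 1] are determined by their moments *)

Lemma cvg_mulrn_geometric (R : realType) (q : R) : 0 <= q < 1 ->
  (n%:R * q ^+ n : R) @[n --> \oo] --> (0 : R).
Proof.
move=> /andP[]; rewrite le_eqVlt => /predU1P[<- _|q0 q1].
  apply: cvg_near_cst; near=> n; have n0 : (0 < n)%N by near: n; exists 1%N.
  by rewrite expr0n (gtn_eqF n0) mulr0.
pose c := - ln q; have c0 : 0 < c by rewrite oppr_gt0 ln_lt0// q0.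
have qE n : q ^+ n = expR (- (c * n%:R)).
  by rewrite /c mulNr opprK mulrC expRM_natl lnK.
apply/cvgrPdist_le => e e0; near=> n.
have n0 : 0 < n%:R :> R by rewrite ltr0n; near: n; exists 1%N.
(* With x = c n / 2, exp (c n) = (exp x)^2 >= x^2, hence n q^n <= 4 / (c^2 n), which is at most e
   for these n. *)
have ne : 4 / (c ^+ 2 * e) <= n%:R by near: n; exact: nbhs_infty_ger.
rewrite sub0r normrN ger0_norm ?mulr_ge0 ?exprn_ge0 ?(ltW n0) ?(ltW q0)// qE expRN.
rewrite ler_pdivrMr ?expR_gt0//.
have : 1 + c * n%:R / 2 <= expR (c * n%:R / 2) by exact: expR_ge1Dx.
set x := c * n%:R / 2 => h.
have -> : expR (c * n%:R) = expR x ^+ 2 by rewrite -expRM_natl; congr expR; rewrite /x; field.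
have x0 : 0 < x by rewrite /x divr_gt0// mulr_gt0.
apply: (@le_trans _ _ (e * x ^+ 2)); last first.
  by rewrite ler_pM2l// lerXn2r ?nnegrE ?expR_ge0 ?(ltW x0)//; lra.
rewrite /x; rewrite ler_pdivrMr ?mulr_gt0 ?exprn_gt0// in ne.
have -> : e * (c * n%:R / 2) ^+ 2 = n%:R * (n%:R * (c ^+ 2 * e)) / 4 by field.
by rewrite ler_pdivlMr// ler_pM2l.
Unshelve. all: by end_near. Qed.

Section moment_unique.
Context (R : realType).
Let D : set R := `[0, 1]%classic.

(** On [0, 1], (1 - u^n)^m behaves like exp (- m u^n), and here m u^n is close to n (u/b)^n, which
    tends to 0 for u < b and to infinity for u >= b. The factor n in the exponent settles the
    boundary case u = b. *)
Definition cutoff_poly (b : R) n : {poly R} :=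
  (1 - 'X^n) ^+ (Num.truncn (n%:R / b ^+ n)).

Lemma horner_cutoff_poly b n u :
  (cutoff_poly b n).[u] = (1 - u ^+ n) ^+ Num.truncn (n%:R / b ^+ n).
Proof. by rewrite /cutoff_poly horner_exp !hornerE. Qed.

Lemma cutoff_poly_itv b n (u : R) : D u -> 0 <= (cutoff_poly b n).[u] <= 1.
Proof.
rewrite /D /= in_itv/= => /andP[u0 u1].
have h1 : u ^+ n <= 1 by rewrite exprn_ile1.
have h0 : 0 <= u ^+ n by rewrite exprn_ge0.
by rewrite horner_cutoff_poly exprn_ge0/= ?exprn_ile1//; lra.
Qed.

Lemma bernoulli_le (x : R) m : 0 <= x <= 1 -> 1 - m%:R * x <= (1 - x) ^+ m.
Proof.
move=> x01; elim: m => [|m ih]; first by rewrite expr0 mul0r subr0.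
rewrite exprS; apply: (@le_trans _ _ ((1 - x) * (1 - m%:R * x))).
  have : 0 <= m%:R * x * x by rewrite !mulr_ge0//; lra.
  rewrite -natr1; nra.
by rewrite ler_wpM2l//; lra.
Qed.

Lemma cvg_cutoff_poly b (u : R) : 0 < b <= 1 -> D u ->
  (cutoff_poly b n).[u] @[n --> \oo] --> (\1_`]-oo, b[ u : R).
Proof.
rewrite /D /= in_itv/= => /andP[b0 b1] /andP[u0 u1].
have un1 n : u ^+ n <= 1 by rewrite exprn_ile1.
have un0 n : 0 <= u ^+ n by rewrite exprn_ge0.
have m0 n : 0 <= n%:R / b ^+ n :> R by rewrite divr_ge0// exprn_ge0// ltW.
have m_le n : (Num.truncn (n%:R / b ^+ n))%:R <= n%:R / b ^+ n :> R.
  by rewrite truncn_le.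
have m_gt n : n%:R / b ^+ n < (Num.truncn (n%:R / b ^+ n)).+1%:R :> R.
  by rewrite truncnS_gt.
under eq_fun do rewrite horner_cutoff_poly.
have [ub|bu] := ltP u b.
  rewrite indicE mem_set /=; last by rewrite in_itv.
  have q01 : 0 <= u / b < 1 by rewrite divr_ge0 ?(ltW b0)//= ltr_pdivrMr// mul1r.
  (* The lower bound is Bernoulli's inequality with m <= n / b^n. *)
  apply: (@squeeze_cvgr _ _ _ _ (fun n => 1 - n%:R * (u / b) ^+ n) (cst 1)).
  - apply: nearW => n; apply/andP; split; last first.
      by rewrite exprn_ile1//; have := un0 n; have := un1 n; lra.
    apply: le_trans (bernoulli_le _ _); last by rewrite un0 un1.
    rewrite lerB// expr_div_n.
    by rewrite [leRHS]mulrCA mulrC ler_wpM2l.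
  - rewrite -[X in _ --> X]subr0; apply: cvgB; [exact: cvg_cst|exact: cvg_mulrn_geometric].
  - exact: cvg_cst.
rewrite indicE memNset /=; last by rewrite in_itv/=; apply/negP; rewrite -leNgt.
(* From (m + 1) u^n >= (m + 1) b^n > n one gets m u^n > n - 1; the factor exp 1 pays for truncating
   the exponent. *)
apply: (@squeeze_cvgr _ _ _ _ (cst 0) (fun n => expR 1 * expR (- 1) ^+ n)).
- apply: nearW => n; apply/andP; split; first by rewrite exprn_ge0// subr_ge0.
  set m := Num.truncn _.
  have h1 : 1 - u ^+ n <= expR (- u ^+ n) by apply: le_trans (expR_ge1Dx _); rewrite addrC.
  apply: (@le_trans _ _ (expR (- u ^+ n) ^+ m)).
    by rewrite lerXn2r ?nnegrE ?expR_ge0// subr_ge0.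
  rewrite -!expRM_natl -expRD ler_expR.
  have bn0 : 0 < b ^+ n by rewrite exprn_gt0.
  have hb : b ^+ n <= u ^+ n by rewrite lerXn2r ?nnegrE// ltW.
  have := m_gt n; rewrite -/m ltr_pdivrMr// -natr1 => hm.
  have : (m%:R + 1) * b ^+ n <= (m%:R + 1) * u ^+ n by rewrite ler_wpM2l// addr_ge0.
  have nu : n%:R * u ^+ n <= n%:R by rewrite ler_piMr.
  have n_ge0 : 0 <= n%:R :> R by [].
  have := un1 n.
  rewrite !mulrN mulr1; move: hm; lra.
- exact: cvg_cst.
- rewrite -[X in _ --> X](mulr0 (expR 1)); apply: cvgM; first exact: cvg_cst.
  apply: cvg_expr; rewrite ger0_norm ?expR_ge0//; by rewrite -expR0 ltr_expR; lra.
Qed.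

(** Equal moments give equal integrals of polynomials and, by dominated convergence along
    [cutoff_poly], equal masses of the half-lines ]-oo, b[. These are stable under intersection and
    generate the Borel sets. *)
Lemma moments_unique (mu nu : {measure set R -> \bar R}) :
  (mu setT < +oo)%E -> (nu setT < +oo)%E ->
  mu (~` D) = 0%E -> nu (~` D) = 0%E ->
  (forall k, \int[mu]_(u in D) (u ^+ k)%:E = \int[nu]_(u in D) (u ^+ k)%:E)%E ->
  forall A, measurable A -> mu A = nu A.
Proof.
move=> muT nuT muD nuD momE.
have mD : measurable D by exact: measurable_itv.
have mX k : measurable_fun D (fun u : R => u ^+ k) by exact: exprn_measurable.
have mp (p : {poly R}) : measurable_fun D (fun u => (p.[u])%:E).
  rewrite (_ : (fun _ => _) = EFin \o (fun u => \sum_(i < size p) p`_i * u ^+ i)); last first.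
    by apply/funext => u; rewrite /= horner_coef.
  apply/measurable_EFinP.
  by apply: measurable_sum => i; exact: measurable_funM.
have mfin (m : {measure set R -> \bar R}) A : (m setT < +oo)%E -> measurable A -> (m A < +oo)%E.
  by move=> mT mA; apply: le_lt_trans mT; apply: le_measure; rewrite ?inE.
have iX (m : {measure set R -> \bar R}) k : (m setT < +oo)%E -> m.-integrable D (fun u => (u ^+ k)%:E).
  move=> mT; apply: (@measurable_bounded_integrable _ _ _ m (fun u : R => u ^+ k)) => //.
    exact: mfin.
  exists 1; split; first exact: num_real.
  move=> x x1 u; rewrite /D /= in_itv/= => /andP[u0 u1].
  by rewrite ger0_norm ?exprn_ge0// (le_trans _ (ltW x1))// exprn_ile1.
have polyE (p : {poly R}) : (\int[mu]_(u in D) (p.[u])%:E = \int[nu]_(u in D) (p.[u])%:E)%E.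
  have intp (m : {measure set R -> \bar R}) : (m setT < +oo)%E ->
      (\int[m]_(u in D) (p.[u])%:E = \sum_(i < size p) (p`_i)%:E * \int[m]_(u in D) (u ^+ i)%:E)%E.
    move=> mT; under eq_integral do rewrite horner_coef -sumEFin.
    rewrite integral_sum//; last by move=> i; exact: (integrableZl mD _ (iX m i mT)).
    by apply: eq_bigr => i _; rewrite -integralZl//; exact: iX.
  by rewrite !intp//; apply: eq_bigr => i _; rewrite momE.
have half (m : {measure set R -> \bar R}) b : (m setT < +oo)%E -> 0 < b <= 1 ->
    (\int[m]_(u in D) ((cutoff_poly b n).[u])%:E)%E @[n --> \oo] --> m (`]-oo, b[ `&` D).
  move=> mT b01; rewrite -integral_indic//.
  apply: (@dominated_cvg _ _ _ m D mD _ _ (cst 1%E)).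
  - by move=> n; exact: mp.
  - by move=> u Du; apply: cvg_EFin; [exact: nearW|exact: cvg_cutoff_poly].
  - by [].
  - by have := iX m 0%N mT; apply: eq_integrable => // u _; rewrite expr0.
  - move=> n u Du; have /andP[p0 p1] := cutoff_poly_itv b n Du.
    by rewrite gee0_abs lee_fin.
have mI (m : {measure set R -> \bar R}) A : measurable A -> m (~` D) = 0%E -> m A = m (A `&` D).
  move=> mA mD0; rewrite -[in LHS](setIT A) -(setUv D) setIUr measureU//.
  - rewrite [X in (_ + X)%E](_ : _ = 0%E) ?adde0//.
    by apply: (subset_measure0 _ _ _ mD0) => //; [apply: measurableI => //; exact: measurableC|exact: measurableC].
  - exact: measurableI.
  - by apply: measurableI => //; exact: measurableC.
  - by rewrite setIACA setICr setI0.
have halfE b : mu `]-oo, b[%classic = nu `]-oo, b[%classic.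
  rewrite (mI mu)// (mI nu)//.
  have [b0|b0] := leP b 0.
    rewrite (_ : _ `&` _ = set0) ?measure0//; apply/seteqP; split => // u /=.
    by rewrite /D /= !in_itv/= => -[ub /andP[u0 _]]; move: (lt_le_trans ub b0); rewrite ltNge u0.
  have [b1|b1] := leP b 1.
    have b01 : 0 < b <= 1 by rewrite b0.
    have h1 : (\int[nu]_(u in D) ((cutoff_poly b n).[u])%:E)%E @[n --> \oo] --> mu (`]-oo, b[ `&` D).
      by under eq_fun do rewrite -polyE; exact: half.
    exact: cvg_unique h1 (half nu b nuT b01).
  (* For b > 1 the half-line contains [0, 1], whose mass is the zeroth moment. *)
  rewrite setIidr; last first.
    by move=> u; rewrite /D /= !in_itv/= => /andP[_ u1]; exact: le_lt_trans b1.
  have mass (m : {measure set R -> \bar R}) : (\int[m]_(u in D) (u ^+ 0)%:E)%E = m D.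
    by rewrite -[RHS]mul1e -integral_cst//; apply: eq_integral => u _; rewrite expr0.
  by rewrite -!mass momE.
move=> A mA.
apply: (@measure_unique _ _ _ (@RGenInftyO.G R) (fun k : nat => `]-oo, k%:R[%classic) _ _ _ _ mu nu) => //.
- exact: RGenInftyO.measurableE.
- move=> _ _ [x ->] [y ->]; exists (Num.min x y).
  by apply/seteqP; split => u /=; rewrite !in_itv/= lt_min => /andP.
- by move=> k; exists k%:R.
- apply/seteqP; split => // u _; exists (Num.truncn u).+1 => //=.
  by rewrite in_itv/= truncnS_gt.
- by move=> _ [x ->]; exact: halfE.
- by move=> k; exact: mfin.
Qed.
End moment_unique.

(** * Integrals over the plane and the half-line *)

Section calculus.
Context (R : realType).
Local Notation mu := (@lebesgue_measure R).

Lemma integral_expRN_tail (c : R) :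
  (\int[mu]_(v in `[c, +oo[) (expR (- v))%:E = (expR (- c))%:E)%E.
Proof.
have dF (x : R) : is_derive x 1 (fun v : R => - expR (- v)) (expR (- x)).
  rewrite [X in is_derive _ _ _ X](_ : _ = - (expR (- x) * -1)); last by rewrite mulrN1 opprK.
  exact: is_deriveN.
have cexpN : continuous (fun z : R => expR (- z)).
  move=> x; apply: continuous_comp; last exact: continuous_expR.
  exact: opp_continuous.
rewrite (@ge0_continuous_FTC2y _ _ (fun v => - expR (- v)) c 0).
- by rewrite sub0e -EFinN opprK.
- by move=> x _; exact: expR_ge0.
- exact: continuous_subspaceT.
- rewrite -oppr0; apply: cvgN; exact: cvgr_expR.
- by move=> x _; exact: ex_derive.
- by apply: cvg_at_right_filter; apply: cvgN; exact: cexpN.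
- by move=> x _; rewrite derive1E derive_val.
Qed.

(** The area of a half-disc of squared radius q: substituting x = sqrt q * sin theta leaves q cos^2
    theta on [-pi/2, pi/2]. *)
Lemma integral_cos2 (q : R) : 0 < q ->
  (\int[mu]_(x in `[(- Num.sqrt q)%R, Num.sqrt q]) (Num.sqrt (q - x ^+ 2))%:E =
  (q * pi / 2)%:E)%E.
Proof.
move=> q0; have sq0 : 0 < Num.sqrt q by rewrite sqrtr_gt0.
pose F (x : R) := Num.sqrt q * sin x.
have dF (x : R) : is_derive x 1 F (Num.sqrt q * cos x).
  by apply: is_deriveZ.
have cF : continuous F.
  move=> x; apply: differentiable_continuous; apply/derivable1_diffP; exact: ex_derive.
have F1 : F^`()%classic = fun x => Num.sqrt q * cos x.
  by apply/funext => x; rewrite derive1E derive_val.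
have cF1 : continuous F^`()%classic.
  rewrite F1 => x; apply: cvgM; [exact: cvg_cst|exact: continuous_cos].
have pi0 : - (pi / 2) < pi / 2 :> R by have := pi_gt0 R; lra.
have FN : F (- (pi / 2)) = - Num.sqrt q by rewrite /F sinN sin_pihalf mulrN mulr1.
have FP : F (pi / 2) = Num.sqrt q by rewrite /F sin_pihalf mulr1.
rewrite -FN -FP.
rewrite integration_by_substitution_increasing ?(ltW pi0)//; last 5 first.
- by move=> x y xI yI xy; rewrite /F ltr_pM2l// ltr_sin.
- by apply/cvg_ex; exists (F^`()%classic (- (pi / 2))); apply: cvg_at_right_filter; exact: cF1.
- by apply/cvg_ex; exists (F^`()%classic (pi / 2)); apply: cvg_at_left_filter; exact: cF1.
- split => //.
  + by apply: cvg_at_right_filter; exact: cF.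
  + by apply: cvg_at_left_filter; exact: cF.
- apply: continuous_subspaceT => x; apply: continuous_comp; last exact: sqrt_continuous.
  apply: cvgB; first exact: cvg_cst.
  exact: exprn_continuous.
transitivity (\int[mu]_(x in `[(- (pi / 2))%R, (pi / 2)%R]) (q * cos x ^+ 2)%:E)%E.
  apply: eq_integral => x; rewrite inE/= in_itv/= => xI; congr EFin.
  change (Num.sqrt (q - F x ^+ 2) * F^`()%classic x = q * cos x ^+ 2).
  rewrite F1 /F exprMn sqr_sqrtr ?(ltW q0)//.
  rewrite (_ : q - _ = q * cos x ^+ 2); last by rewrite cos2sin2; ring.
  rewrite sqrtrM ?(ltW q0)// sqrtr_sqr ger0_norm; last exact: cos_ge0_pihalf.
  by rewrite mulrACA -!expr2 sqr_sqrtr// ltW.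
pose H (x : R) := q * (2^-1 * x + 2^-1 * (sin x * cos x)).
have dH (x : R) : is_derive x 1 H (q * cos x ^+ 2).
  have E : q * cos x ^+ 2 = q *: (2^-1 *: 1 + 2^-1 *: (sin x *: (- sin x) + cos x *: cos x)) :> R.
    by rewrite /GRing.scale/= mulrN -!expr2 cos2sin2; field.
  rewrite E.
  have Hsc : is_derive x 1 (sin * cos : R -> R) (sin x *: (- sin x) + cos x *: cos x).
    exact: is_deriveM.
  apply: is_deriveZ.
have cH : continuous H.
  move=> x; apply: differentiable_continuous; apply/derivable1_diffP; exact: ex_derive.
rewrite (@continuous_FTC2 _ _ H)//.
- by rewrite -EFinB /H cosN cos_pihalf !mulr0; congr EFin; field.
- apply: continuous_subspaceT => x; apply: cvgM; first exact: cvg_cst.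
  by rewrite expr2; apply: cvgM; exact: continuous_cos.
- split.
  + by move=> x _; exact: ex_derive.
  + by apply: cvg_at_right_filter; exact: cH.
  + by apply: cvg_at_left_filter; exact: cH.
- by move=> x _; rewrite derive1E derive_val.
Qed.

Local Notation GR := (measurableTypeR R).

Lemma area_disc (q : R) : 0 < q ->
  (mu \x mu)%E [set x : GR * GR | x.1 ^+ 2 + x.2 ^+ 2 <= q] = (q * pi)%:E.
Proof.
move=> q0; rewrite /product_measure1 /=.
(* [Num.sqrt] vanishes on negative numbers, so this section length is also correct for the empty
   sections x^2 > q. *)
transitivity (\int[mu]_x (2 * Num.sqrt (q - x ^+ 2))%:E)%E.
  apply: eq_integral => x _ /=.
  have [qx|qx] := ltP (q - x ^+ 2) 0.
    rewrite (_ : xsection _ _ = set0).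
      by rewrite measure0 ler0_sqrtr ?mulr0// ltW.
    apply/seteqP; split => y //; rewrite /xsection /= inE/= -lerBrDl => h.
    by have := le_lt_trans h qx; rewrite ltNge sqr_ge0.
  rewrite (_ : xsection _ _ = `[(- Num.sqrt (q - x ^+ 2))%R, Num.sqrt (q - x ^+ 2)]%classic); last first.
    apply/seteqP; split => y; rewrite /xsection /= inE/= in_itv/= -ler_norml -lerBrDl.
      by move=> h; rewrite -[leLHS]ger0_norm// -sqrtr_sqr (real_normK (num_real y)) ler_sqrt.
    by move=> h; rewrite -(real_normK (num_real y)) -[leRHS]sqr_sqrtr// lerXn2r ?nnegrE ?sqrtr_ge0.
  rewrite lebesgue_measure_itv/= lte_fin; have := sqrtr_ge0 (q - x ^+ 2).
  by case: ltP => h h'; rewrite -?EFinB; congr EFin; lra.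
transitivity (2%:E * \int[mu]_(x in `[(- Num.sqrt q)%R, Num.sqrt q]) (Num.sqrt (q - x ^+ 2))%:E)%E; last first.
  by rewrite integral_cos2// -EFinM; congr EFin; field.
have ms : measurable_fun setT (fun x : R => Num.sqrt (q - x ^+ 2)).
  apply: continuous_measurable_fun => x; apply: continuous_comp; last exact: sqrt_continuous.
  apply: cvgB; first exact: cvg_cst.
  exact: exprn_continuous.
under eq_integral do rewrite EFinM.
rewrite ge0_integralZl//; last exact/measurable_EFinP.
congr (_ * _)%E; rewrite [RHS]integral_mkcond.
apply: eq_integral => x _; rewrite patchE; case: ifPn => // xq.
congr EFin; apply/eqP; rewrite sqrtr_eq0 subr_le0.
move: xq; rewrite notin_setE/= in_itv/= => /negP; rewrite -ler_norml -ltNge => xq.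
by rewrite -(real_normK (num_real x)) -[leLHS]sqr_sqrtr ?(ltW q0)// lerXn2r ?nnegrE ?sqrtr_ge0// ltW.
Qed.

Lemma integral_affine0 (b : R) : 0 <= b ->
  (\int[mu]_(r in `[0%R, b]) (2 * r)%:E = (b ^+ 2)%:E)%E.
Proof.
rewrite le_eqVlt => /predU1P[<-|b0].
  by rewrite set_itv1 integral_set1 expr0n.
have cX : continuous (fun r : R => r ^+ 2) by exact: exprn_continuous.
have dX (x : R) : is_derive x 1 (fun r : R => r ^+ 2) (2 * x).
  rewrite [X in is_derive _ _ _ X](_ : _ = x *: (1 : R) + x *: (1 : R)); last first.
    by rewrite /GRing.scale/= mulr1 -mulr2n mulr_natl.
  exact: (is_deriveM (is_derive_id x 1) (is_derive_id x 1)).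
rewrite (@continuous_FTC2 _ _ (fun r => r ^+ 2))//.
- by rewrite expr0n sube0.
- apply: continuous_subspaceT => x; apply: cvgM; [exact: cvg_cst|exact: cvg_id].
- split.
  + by move=> x _; exact: ex_derive.
  + by apply: cvg_at_right_filter; exact: cX.
  + by apply: cvg_at_left_filter; exact: cX.
- by move=> x _; rewrite derive1E derive_val.
Qed.

(** * Exponential integrals through the distribution of the exponent *)

Section exponential_layer.
Local Open Scope ereal_scope.
Context d (T : measurableType d) (m : {sigma_finite_measure set T -> \bar R}).
Variable Y : T -> R.
Hypothesis mY : measurable_fun setT Y.

Let mlayer (A : set (T * GR)) (g : T -> R) : measurable_fun setT g -> measurable A ->
  measurable_fun setT (fun z : T * GR => (g z.1 * (\1_A z * expR (- z.2)))%:E : \bar R).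
Proof.
move=> mg mA; apply/measurable_EFinP; apply: measurable_funM; first exact: measurableT_comp.
apply: measurable_funM; first exact: measurable_indic.
apply: measurableT_comp; first exact: measurable_expR.
apply: measurable_funN; exact: (measurable_snd : measurable_fun setT (snd : T * GR -> R)).
Qed.

Let m2 : measurable_fun setT (snd : T * GR -> R).
Proof. exact: measurable_snd. Qed.

Let mY1 : measurable_fun setT (fun z : T * GR => Y z.1).
Proof. exact: measurableT_comp. Qed.

(** Tonelli applied to exp (- Y) = int_(v >= Y) exp (- v) dv. *)
Lemma integral_expRN_layer (g : T -> R) :
  measurable_fun setT g -> (forall x, (0 <= g x)%R) ->
  \int[m]_x (g x * expR (- Y x))%:E =
  \int[mu]_v ((expR (- v))%:E * \int[m]_x (g x * \1_[set x | (Y x <= v)%R] x)%:E).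
Proof.
move=> mg g0.
pose A := [set z : T * GR | (Y z.1 <= z.2)%R].
have mA : measurable A by apply: measurable_is_true; exact: measurable_fun_ler.
pose f (z : T * GR) : \bar R := (g z.1 * (\1_A z * expR (- z.2)))%:E.
have f0 z : 0 <= f z by rewrite lee_fin !mulr_ge0// expR_ge0.
transitivity (\int[m]_x \int[mu]_v f (x, v)).
  apply: eq_integral => x _; rewrite /f/=; under eq_integral do rewrite EFinM.
  have mx : measurable_fun setT (fun v : GR => (\1_A (x, v) * expR (- v))%:E : \bar R).
    have := measurable_fun_pair2 x (@mlayer A (cst 1%R) (measurable_cst _) mA).
    by under eq_fun do rewrite /= mul1r.
  rewrite ge0_integralZl ?lee_fin//.
  rewrite EFinM -integral_expRN_tail; congr (_ * _).
  rewrite [LHS]integral_mkcond; apply: eq_integral => v _.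
  rewrite patchE indicE; case: ifPn => vY.
    rewrite mem_set ?mul1r//; by move: vY; rewrite inE/= in_itv/= andbT.
  rewrite memNset ?mul0r// /A/=; move: vY; rewrite notin_setE/= in_itv/= andbT; exact.
transitivity (\int[mu]_v \int[m]_x f (x, v)).
  exact: (fubini_tonelli f (mlayer mg mA) f0).
apply: eq_integral => v _.
rewrite -ge0_integralZl//; last 2 first.
- apply/measurable_EFinP; apply: measurable_funM => //; apply: measurable_indic.
  by apply: measurable_is_true; exact: measurable_fun_ler.
- by move=> x _; rewrite lee_fin mulr_ge0.
apply: eq_integral => x _; rewrite /f/= -EFinM; congr EFin.
by rewrite !indicE; ring.
Qed.

(** Tonelli applied to 1 - exp (- Y) = int_0^Y exp (- v) dv. For a power-law tail the right side is
    a Gamma integral; 0 is left out because such a tail is known for v > 0 only. *)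
Lemma integral_onem_expRN_layer : (forall x, (0 <= Y x)%R) ->
  \int[m]_x (1 - expR (- Y x))%:E =
  \int[mu]_(v in `]0%R, +oo[) ((expR (- v))%:E * m [set x | (v <= Y x)%R]).
Proof.
move=> Y0.
pose A := [set z : T * GR | (0 < z.2 <= Y z.1)%R].
have mA : measurable A.
  apply: measurable_is_true; apply: measurable_and; first exact: measurable_fun_ltr.
  exact: measurable_fun_ler.
pose f (z : T * GR) : \bar R := (cst 1%R z.1 * (\1_A z * expR (- z.2)))%:E.
have f0 z : 0 <= f z by rewrite lee_fin !mulr_ge0// expR_ge0.
have fE x v : f (x, v) = ((fun v => (expR (- v))%:E) \_ `]0%R, Y x]) v.
  rewrite /f /= mul1r indicE patchE; case: ifPn => [|]; rewrite ?inE ?notin_setE/= in_itv/= => h.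
    by rewrite mem_set ?mul1r.
  by rewrite memNset ?mul0r.
transitivity (\int[m]_x \int[mu]_v f (x, v)).
  apply: eq_integral => x _.
  under eq_integral do rewrite fE; rewrite -integral_mkcond.
  rewrite EFinB -[X in X%:E - _]expR0 -[X in (expR X)%:E - _]oppr0 -integral_expRN_tail -integral_itv_obnd_cbnd//; last first.
    apply/measurable_EFinP/measurable_funTS; apply: measurableT_comp; first exact: measurable_expR.
    exact: measurable_funN.
  rewrite (@itv_bndbnd_setU _ _ _ (BRight (Y x)))//; last by rewrite bnd_simp.
  rewrite ge0_integral_setU//=.
  - rewrite [X in _ + X + _]integral_itv_obnd_cbnd//; last first.
      apply/measurable_EFinP/measurable_funTS; apply: measurableT_comp; first exact: measurable_expR.
      exact: measurable_funN.
    by rewrite integral_expRN_tail addeK.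
  - apply/measurable_EFinP/measurable_funTS; apply: measurableT_comp; first exact: measurable_expR.
    exact: measurable_funN.
  - apply/disj_setPS => v [] /=; rewrite !in_itv/= andbT => /andP[_ vY].
    by rewrite ltNge vY.
transitivity (\int[mu]_v \int[m]_x f (x, v)).
  exact: (fubini_tonelli f (mlayer (measurable_cst _) mA) f0).
rewrite [RHS]integral_mkcond; apply: eq_integral => v _; rewrite patchE.
have mv : measurable [set x | (v <= Y x)%R] by apply: measurable_is_true; exact: measurable_fun_ler.
case: ifPn => [|]; rewrite ?inE ?notin_setE/= in_itv/= andbT => v0.
  transitivity (\int[m]_x ((expR (- v))%:E * (\1_[set x | (v <= Y x)%R] x)%:E)).
    apply: eq_integral => x _; rewrite -EFinM /f/= mul1r mulrC !indicE; congr (_ * _%:R)%:E.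
    have [vY|vY] := leP v (Y x); first by rewrite !mem_set// /A/= v0.
    by rewrite !memNset// /A/= leNgt vY// andbF.
  rewrite ge0_integralZl//; last by apply/measurable_EFinP; exact: measurable_indic.
  by rewrite integral_indic// setIT.
rewrite integral0_eq// => x _; rewrite /f/= indicE memNset ?mul0r ?mulr0//.
by rewrite /A/= => /andP[].
Qed.

End exponential_layer.

(** The integrand may be singular at 0, so ]0, 1] is exhausted by the intervals [1/(n+1), 1]. An
    upper bound suffices for the finiteness of [Gamma]. *)
Lemma integral_powR01 (s : R) : 0 < s ->
  (\int[mu]_(u in `]0%R, 1%R]) (u `^ (s - 1))%:E <= (s^-1)%:E)%E.
Proof.
move=> s0.
pose F n := `[n.+1%:R^-1 : R, 1%R]%classic.
have FU : `]0%R, 1%R]%classic = \bigcup_n F n.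
  apply/seteqP; split => u /=; rewrite in_itv/=.
    move=> /andP[u0 u1]; exists (Num.truncn u^-1) => //.
    rewrite /F /= in_itv/= u1 andbT invf_ple ?posrE//.
    by apply: ltW; rewrite truncnS_gt.
  move=> [n _]; rewrite /F /= in_itv/= => /andP[nu ->]; rewrite andbT.
  by apply: lt_le_trans nu; rewrite invr_gt0.
have ndF : nondecreasing_seq F.
  move=> m n mn; apply/subsetPset => u; rewrite /F /= !in_itv/= => /andP[mu' ->].
  by rewrite andbT (le_trans _ mu')// lef_pV2 ?posrE// ler_nat.
have F0 n u : F n u -> 0 < u.
  rewrite /F/= in_itv/= => /andP[nu _]; apply: lt_le_trans nu.
  by rewrite invr_gt0.
have dH (x : R) : 0 < x -> is_derive x 1 (fun u : R => s^-1 * u `^ s) (x `^ (s - 1)).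
  move=> x0; rewrite [X in is_derive _ _ _ X](_ : _ = s^-1 *: (s * x `^ (s - 1))).
    by apply: is_deriveZ; exact: is_derive1_powR.
  by rewrite /GRing.scale/= mulrA mulVf ?mul1r// gt_eqF.
have cH (p x : R) : 0 < x -> {for x, continuous (fun u : R => u `^ p)}.
  move=> x0; apply: differentiable_continuous; apply/derivable1_diffP.
  by apply: derivable_powR; rewrite in_itv/= andbT.
have : (\int[mu]_(u in F n) (u `^ (s - 1))%:E)%E @[n --> \oo] -->
    (\int[mu]_(u in \bigcup_n F n) (u `^ (s - 1))%:E)%E.
  apply: ge0_nondecreasing_set_cvg_integral => //.
  - by move=> n; exact: measurable_itv.
  - by move=> n; apply/measurable_EFinP/measurable_funTS; exact: measurable_powR.
  - by move=> n x _; rewrite lee_fin powR_ge0.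
rewrite -FU => /cvg_lim <-//; apply: lime_le.
  apply: ereal_nondecreasing_is_cvgn; apply: ge0_nondecreasing_set_nondecreasing_integral => //.
  - by move=> n; exact: measurable_itv.
  - by move=> n; apply/measurable_EFinP/measurable_funTS; exact: measurable_powR.
  - by move=> n x _; rewrite lee_fin powR_ge0.
apply: nearW => n; rewrite /F.
(* For n = 0 the interval is the point 1, out of reach of the fundamental theorem. *)
have [n0|n0] := leP 1 (n.+1%:R^-1 : R).
  rewrite (le_trans _ (_ : 0 <= _)%E) ?lee_fin ?invr_ge0 ?(ltW s0)//.
  by rewrite (@integral_Sset1 _ _ _ 1)// => u /=; rewrite in_itv/= => /andP[h1 h2]; apply/eqP; rewrite eq_le h2 (le_trans n0 h1).
rewrite (@continuous_FTC2 _ _ (fun u => s^-1 * u `^ s))//.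
- by rewrite powR1 mulr1 -EFinB lee_fin lerBlDr lerDl mulr_ge0 ?powR_ge0// invr_ge0 ltW.
- apply: continuous_in_subspaceT => x; rewrite inE => /F0 x0; exact: cH.
- split.
  + move=> x; rewrite in_itv/= => /andP[nx _].
    have x0 : 0 < x by apply: lt_trans nx; rewrite invr_gt0.
    by have [] := dH _ x0.
  + apply: cvg_at_right_filter; apply: cvgM; [exact: cvg_cst|apply: cH; by rewrite invr_gt0].
  + by apply: cvg_at_left_filter; apply: cvgM; [exact: cvg_cst|exact: cH].
- move=> x; rewrite in_itv/= => /andP[nx _].
  have x0 : 0 < x by apply: lt_trans nx; rewrite invr_gt0.
  by rewrite derive1E; have [_ ->] := dH _ x0.
Qed.

(** The layer formula for Y = id and the weight 1 on [0, +oo[, read from right to left: the inner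
    integral is the length v of [0, v]. *)
Lemma integral_mul_expRN :
  (\int[mu]_(u in `[0%R, +oo[) (u * expR (- u))%:E = 1)%E.
Proof.
have mi : measurable_fun setT (\1_`[0%R, +oo[%classic : GR -> R) by exact: measurable_indic.
have i0 (x : GR) : 0 <= (\1_`[0%R, +oo[%classic : GR -> R) x by [].
have := @integral_expRN_layer _ _ mu idfun (@measurable_id _ _ _) _ mi i0.
rewrite (_ : (fun x => _) = (fun v => (expR (- v))%:E) \_ `[0%R, +oo[); last first.
  by apply/funext => v; rewrite patchE indicE; case: ifPn => _; rewrite ?mul1r ?mul0r.
rewrite -integral_mkcond integral_expRN_tail oppr0 expR0 => ->.
rewrite [LHS]integral_mkcond; apply: eq_integral => v _.
transitivity ((expR (- v))%:E *
    \int[mu]_r (\1_(`[0%R, +oo[%classic `&` [set r | r <= v]) r)%:E)%E; last first.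
  by congr (_ * _)%E; apply: eq_integral => r _; rewrite indicI.
rewrite integral_indic//; last by apply: measurableI => //; apply: measurable_is_true; exact: measurable_fun_ler.
rewrite setIT patchE; case: ifPn => [|]; rewrite ?inE ?notin_setE/= in_itv/= andbT => v0.
  rewrite (_ : _ `&` _ = `[0%R, v]%classic); last first.
    by apply/seteqP; split => r /=; rewrite !in_itv/= andbT => /andP.
  rewrite lebesgue_measure_itv/= lte_fin; case: ltP => h; first by rewrite sube0 EFinM muleC.
  by rewrite mule0; congr EFin; have -> : v = 0 by [apply/eqP; rewrite eq_le h]; rewrite mul0r.
rewrite (_ : _ `&` _ = set0) ?measure0 ?mule0//.
apply/seteqP; split => // r /=; rewrite in_itv/= andbT => -[r0 rv]; apply: v0.
exact: le_trans rv.
Qed.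

(** [Gamma] is the [fine] part of this integral, so the content is finiteness. The integrand is at
    most u^(x-1) on ]0, 1] and at most u exp (- u) beyond 1, where x <= 2 is used; the arguments
    that occur later are 1 - 2/beta and 1 + 2/beta. *)
Lemma GammaE (x : R) : 0 < x <= 2 ->
  (\int[mu]_(u in `]0%R, +oo[) (u `^ (x - 1) * expR (- u))%:E = (Gamma x)%:E)%E.
Proof.
move=> /andP[x0 x2]; rewrite /Gamma /Rintegral fineK//.
have mf (D : set R) : measurable_fun D (fun u => (u `^ (x - 1) * expR (- u))%:E).
  apply/measurable_EFinP/measurable_funTS; apply: measurable_funM; first exact: measurable_powR.
  by apply: measurableT_comp; [exact: measurable_expR|exact: measurable_funN].
have f0 (u : R) : (0 <= (u `^ (x - 1) * expR (- u))%:E)%E.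
  by rewrite lee_fin mulr_ge0 ?powR_ge0// expR_ge0.
rewrite ge0_fin_numE; last exact: integral_ge0.
rewrite (@itv_bndbnd_setU _ _ _ (BRight 1))//; last by rewrite bnd_simp.
have disj : [disjoint (`]0, 1]%classic : set R) & (`]1, +oo[%classic : set R)]%classic.
  apply/disj_setPS => v [] /=; rewrite !in_itv/= andbT => /andP[_ v1].
  by rewrite ltNge v1.
rewrite ge0_integral_setU//=; last exact: mf.
apply: (@le_lt_trans _ _ ((x^-1)%:E + 1)%E); last by rewrite -EFinD ltry.
apply: leeD.
  apply: le_trans (integral_powR01 x0); apply: ge0_le_integral => //.
  - exact: mf.
  - by apply/measurable_EFinP/measurable_funTS; exact: measurable_powR.
  - move=> u; rewrite /= in_itv/= => /andP[u0 _]; rewrite lee_fin ler_piMr ?powR_ge0//.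
    by rewrite -expR0 ler_expR lerNl oppr0 ltW.
rewrite -integral_mul_expRN.
have mg (D : set R) : measurable_fun D (fun u => (u * expR (- u))%:E).
  apply/measurable_EFinP/measurable_funTS; apply: measurable_funM => //.
  by apply: measurableT_comp; [exact: measurable_expR|exact: measurable_funN].
apply: (@le_trans _ _ (\int[mu]_(u in `]1%R, +oo[) (u * expR (- u))%:E)%E).
  apply: ge0_le_integral => //.
  - exact: mf.
  - exact: mg.
  - move=> u; rewrite /= in_itv/= andbT => u1; rewrite lee_fin ler_wpM2r ?expR_ge0//.
    rewrite -[leRHS]powRr1 ?ler_powR ?(ltW u1)//; first lra.
    by rewrite ltW// (lt_trans ltr01).
apply: ge0_subset_integral => //.
- exact: mg.
- by move=> u; rewrite /= in_itv/= andbT => u0; rewrite lee_fin mulr_ge0 ?expR_ge0.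
- by move=> u /=; rewrite !in_itv/= !andbT => u1; rewrite ltW// (lt_trans ltr01).
Qed.

(** The weight 2 r gives the sublevel set {r >= 0, y r^beta <= v} = [0, b], with b = (v/y)^(1/beta),
    the mass b^2 = (v/y)^(2/beta); integrating this against exp (- v) produces the Gamma value. *)
Lemma integral_expRN_powR (beta y : R) : 2 <= beta -> 0 < y ->
  (\int[mu]_(r in `[0%R, +oo[) (2 * r * expR (- (y * r `^ beta)))%:E =
   (Gamma (1 + 2 / beta) * y `^ (- (2 / beta)))%:E)%E.
Proof.
move=> beta2 y0; have beta0 : 0 < beta by lra.
pose g (r : R) := 2 * r * \1_`[0%R, +oo[%classic r.
pose Y (r : R) := y * r `^ beta.
have g0 r : 0 <= g r.
  rewrite /g indicE; case: (boolP (_ \in _)) => [|_]; last by rewrite mulr0.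
  by rewrite inE/= in_itv/= andbT => r0; rewrite mulr1 mulr_ge0.
have mg : measurable_fun setT g.
  by apply: measurable_funM; [exact: measurable_funM|exact: measurable_indic].
have mY : measurable_fun setT Y.
  by apply: measurable_funM => //; exact: measurable_powR.
have Y0 r : 0 <= Y r by rewrite mulr_ge0 ?powR_ge0// ltW.
transitivity (\int[mu]_r (g r * expR (- Y r))%:E)%E.
  rewrite integral_mkcond; apply: eq_integral => r _; rewrite patchE /g indicE.
  by case: ifPn => _; rewrite ?mulr1// mulr0 mul0r.
rewrite (@integral_expRN_layer _ _ mu Y mY g mg g0).
have inner v : 0 <= v -> (\int[mu]_r (g r * \1_[set r | Y r <= v] r)%:E)%E = ((v / y) `^ (2 / beta))%:E.
  move=> v0; have vy0 : 0 <= v / y by rewrite divr_ge0// ltW.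
  pose b := (v / y) `^ beta^-1.
  have -> : (v / y) `^ (2 / beta) = b ^+ 2.
    by rewrite -powR_mulrn ?powR_ge0// -powRrM [beta^-1 * _]mulrC.
  have bE : b `^ beta = v / y by rewrite -powRrM mulVf ?gt_eqF// powRr1.
  rewrite -integral_affine0 ?powR_ge0// [RHS]integral_mkcond.
  apply: eq_integral => r _; rewrite patchE /g.
  have [r0|r0] := leP 0 r; last first.
    rewrite !indicE memNset ?mulr0 ?mul0r; last by rewrite /= in_itv/= andbT leNgt r0.
    by rewrite memNset//= in_itv/= leNgt r0.
  rewrite !indicE mem_set ?mulr1; last by rewrite /= in_itv/= andbT.
  have YE : (Y r <= v) = (r <= b).
    rewrite /Y mulrC -ler_pdivlMr// -bE; have [rb|br] := leP r b.
      by apply: ge0_ler_powR => //; [exact: ltW|exact: powR_ge0].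
    by apply/negbTE; rewrite -ltNge gt0_ltr_powR// nnegrE ?powR_ge0.
  have [rb|br] := leP r b.
    by rewrite !mem_set ?mulr1//= ?in_itv/= ?r0// YE.
  have brF : (r <= b) = false by rewrite leNgt br.
  by rewrite !memNset ?mulr0//= ?in_itv/= ?YE brF ?andbF.
transitivity (\int[mu]_(v in `[0%R, +oo[) ((y `^ (- (2 / beta)))%:E * (v `^ (2 / beta) * expR (- v))%:E))%E.
  rewrite [RHS]integral_mkcond; apply: eq_integral => v _; rewrite patchE.
  case: ifPn => [|]; rewrite ?inE ?notin_setE/= in_itv/= andbT => v0.
    rewrite inner// -!EFinM; congr EFin.
    by rewrite powRM ?invr_ge0 ?(ltW y0)// -(powR_inv1 (ltW y0)) -powRrM mulN1r; ring.
  rewrite integral0_eq ?mule0// => r _; rewrite [\1__ r]indicE memNset ?mulr0//=.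
  apply/negP; rewrite -ltNge; apply: lt_le_trans (Y0 r); rewrite ltNge; exact/negP.
rewrite ge0_integralZl//; last 3 first.
- apply/measurable_EFinP/measurable_funTS; apply: measurable_funM; first exact: measurable_powR.
  by apply: measurableT_comp; [exact: measurable_expR|exact: measurable_funN].
- by move=> v _; rewrite lee_fin mulr_ge0 ?powR_ge0// expR_ge0.
- by rewrite lee_fin powR_ge0.
rewrite -integral_itv_obnd_cbnd; last first.
  apply/measurable_EFinP/measurable_funTS; apply: measurable_funM; first exact: measurable_powR.
  by apply: measurableT_comp; [exact: measurable_expR|exact: measurable_funN].
have b21 : 0 < 1 + 2 / beta <= 2.
  have : 0 < 2 / beta by rewrite divr_gt0.
  have : 2 / beta <= 1 by rewrite ler_pdivrMr// mul1r.
  by move=> h1 h2; apply/andP; split; lra.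
have := GammaE b21; rewrite (_ : 1 + 2 / beta - 1 = 2 / beta); last by rewrite addrC addKr.
by move=> ->; rewrite -EFinM mulrC.
Qed.
End calculus.

(** * The reduced Mecke formula *)

(** For the lower bound, exp (- u) <= 1/(1 + u) <= 1 - u + u^2, the latter because (1 - u + u^2)(1 +
    u) = 1 + u^3. *)
Lemma onem_expRN_bounds (R : realType) (u : R) : 0 <= u ->
  u - u ^+ 2 <= 1 - expR (- u) <= u.
Proof.
move=> u0; have h1 := expR_ge1Dx (- u); have h2 := expR_ge1Dx u.
have h3 := expRxMexpNx_1 u; have h4 := expR_gt0 (- u).
apply/andP; split; last lra.
suff : expR (- u) <= 1 - u + u ^+ 2 by lra.
have h5 : (1 + u) * expR (- u) <= 1 by rewrite -[leRHS]h3 ler_pM2r.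
have h6 : 1 <= (1 - u + u ^+ 2) * (1 + u).
  have -> : (1 - u + u ^+ 2) * (1 + u) = 1 + u ^+ 3 by ring.
  by rewrite lerDl exprn_ge0.
have u1 : 0 < 1 + u by lra.
by rewrite -(ler_pM2l u1) (le_trans h5)// mulrC.
Qed.

Section dyadic_quotient.
Context (R : realType).
Local Open Scope ereal_scope.

(* The difference quotient at 0, with step 2^-n, of [theta |-> - exp (- theta x)]. *)
Definition dyadic_quotient n (x : \bar R) : \bar R :=
  (2 ^+ n)%:E * (1 - expeR (- ((2 ^- n)%:E * x))).

Lemma dyadic_quotient_fin n (r : R) : dyadic_quotient n r%:E =
  (2 ^+ n * (1 - expR (- (2 ^- n * r))))%:E.
Proof. by []. Qed.

Lemma dyadic_quotienty n : dyadic_quotient n +oo = (2 ^+ n)%:E.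
Proof.
by rewrite /dyadic_quotient gt0_muley ?lte_fin ?invr_gt0 ?exprn_gt0//= sube0 mule1.
Qed.

Lemma dyadic_quotient_ge0 n x : 0 <= x -> 0 <= dyadic_quotient n x.
Proof.
move=> x0; rewrite mule_ge0 ?lee_fin ?exprn_ge0// sube_ge0.
  by apply: expeRN_le1; rewrite mule_ge0// lee_fin invr_ge0 exprn_ge0.
by rewrite orbT.
Qed.

Lemma dyadic_quotient_bounds n (r : R) : (0 <= r)%R ->
  (r - r ^+ 2 * 2 ^- n)%:E <= dyadic_quotient n r%:E <= r%:E.
Proof.
move=> r0; rewrite dyadic_quotient_fin !lee_fin.
have p0 : (0 < 2 ^+ n :> R)%R by rewrite exprn_gt0.
have u0 : (0 <= 2 ^- n * r)%R by rewrite mulr_ge0// invr_ge0 ltW.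
have /andP[h1 h2] := onem_expRN_bounds u0.
apply/andP; split.
  rewrite -(ler_pM2l p0) in h1; apply: le_trans h1.
  by rewrite le_eqVlt; apply/orP; left; apply/eqP; field; rewrite gt_eqF.
rewrite -(ler_pM2l p0) in h2; apply: (le_trans h2).
by rewrite mulrA divff ?mul1r// gt_eqF.
Qed.

(** Halving the step: 1 - exp (- 2v) = (1 - exp (- v))(1 + exp (- v)) <= 2 (1 - exp (- v)). This is
    what makes monotone convergence available. *)
Lemma nd_dyadic_quotient x : 0 <= x -> nondecreasing_seq (dyadic_quotient ^~ x).
Proof.
move=> x0; apply/nondecreasing_seqP => n; case: x x0 => [r| |//] r0; last first.
  by rewrite !dyadic_quotienty lee_fin exprS ler_peMl ?exprn_ge0// ler1n.
rewrite !dyadic_quotient_fin lee_fin [X in (_ <= X * _)%R]exprSr -mulrA ler_pM2l ?exprn_gt0//.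
have -> : (2 ^- n * r = 2 ^- (n.+1) * r *+ 2 :> R)%R.
  by rewrite exprS mulr2n; field; rewrite expf_neq0.
set v := (_ * r)%R.
rewrite mulr2n opprD expRD.
have v0 : (0 <= v)%R by rewrite mulr_ge0// invr_ge0 exprn_ge0.
have e1 : (expR (- v) <= 1)%R by rewrite -expR0 ler_expR lerNl oppr0.
have e0 := expR_ge0 (- v); nra.
Qed.

Lemma cvg_half_expn : ((2 ^- n : R) @[n --> \oo] --> (0 : R))%R.
Proof.
under eq_fun do rewrite -exprVn.
by apply: cvg_expr; rewrite ger0_norm ?invr_ge0// invf_lt1// ltr1n.
Qed.

Lemma cvg_dyadic_quotient (x_ : (\bar R)^nat) x : (forall n, 0 <= x_ n) ->
  (forall n, x_ n <= x) -> x_ @ \oo --> x -> (x \is a fin_num \/ forall n, x_ n = x) ->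
  dyadic_quotient n (x_ n) @[n --> \oo] --> x.
Proof.
move=> x0 xx xcvg.
have x00 : 0 <= x by exact: le_trans (xx 0%N).
case: x x00 xx xcvg => [r| |//] r0 xx xcvg xfin; last first.
  case: xfin => // xE; under eq_fun do rewrite xE dyadic_quotienty.
  apply/cvgeyPge => A; near=> n; rewrite lee_fin.
  apply: (@le_trans _ _ n%:R); first by near: n; exact: nbhs_infty_ger.
  by rewrite -natrX ler_nat ltnW// ltn_expl.
have xE n : x_ n = (fine (x_ n))%:E.
  by rewrite fineK// ge0_fin_numE// (le_lt_trans (xx n))// ltry.
have f0 n : (0 <= fine (x_ n))%R by rewrite fine_ge0.
have fr n : (fine (x_ n) <= r)%R by rewrite -lee_fin -xE.
apply: (@squeeze_cvge _ _ _ _ (fun n => x_ n - (r ^+ 2 * 2 ^- n)%:E) _ x_) => //.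
  apply: nearW => n; rewrite xE; have /andP[h1 ->] := dyadic_quotient_bounds n (f0 n).
  rewrite andbT (le_trans _ h1)// -EFinB lee_fin lerB// ler_wpM2r ?invr_ge0 ?exprn_ge0//.
  by rewrite lerXn2r// nnegrE// (le_trans (f0 n)).
rewrite -[X in _ --> X]sube0; apply: cvgeB => //.
apply: cvg_EFin; first exact: nearW.
rewrite /= -(mulr0 (r ^+ 2)%R); apply: cvgM; [exact: cvg_cst|exact: cvg_half_expn].
Unshelve. all: by end_near. Qed.

Lemma measurable_dyadic_quotient n : measurable_fun setT (dyadic_quotient n).
Proof.
apply: emeasurable_funM => //; apply: emeasurable_funB => //.
by apply: measurableT_comp (@measurable_expeRN R) _; exact: emeasurable_funM.
Qed.

End dyadic_quotient.

Lemma product_measure2_eq d1 d2 (T1 : measurableType d1) (T2 : measurableType d2)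
    (R : realType) (m1 : {sigma_finite_measure set T1 -> \bar R})
    (m2 : {sigma_finite_measure set T2 -> \bar R}) (A : set (T1 * T2)) :
  measurable A -> ((m1 \x m2) A = \int[m2]_y m1 (ysection A y))%E.
Proof.
apply: (@product_measure_unique _ _ _ _ _ m1 m2 (m1 \x^ m2)%E) => B C mB mC.
exact: product_measure2E.
Qed.

Lemma cvg_dyadic_quotient_cst (R : realType) (x : \bar R) : (0 <= x)%E ->
  dyadic_quotient n x @[n --> \oo] --> x.
Proof.
move=> x0; apply: (cvg_dyadic_quotient (x_ := fun=> x)) => //; last by right.
exact: cvg_cst.
Qed.

Lemma ge0_integral_mrestr d (T : measurableType d) (R : realType)
    (mu : {measure set T -> \bar R}) (D : set T) (mD : measurable D) (f : T -> \bar R) :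
  measurable_fun setT f -> (forall x, 0 <= f x)%E ->
  (\int[mrestr mu mD]_x f x = \int[mu]_(x in D) f x)%E.
Proof.
move=> mf f0; rewrite [LHS](@ge0_negligible_integral _ _ _ _ _ (~` D))//; last 2 first.
- exact: measurableC.
- by rewrite /= /mrestr setICl measure0.
rewrite setDE setCK setTI; apply: eq_measure_integral => A mA AD.
by rewrite /= /mrestr setIidl.
Qed.

Definition image_measure d d' (T : measurableType d) (T' : measurableType d')
    (R : realType) (mu : {measure set T -> \bar R}) (f : T -> T')
    (mf : measurable_fun setT f) : {measure set T' -> \bar R} :=
  measure_function_pushforward__canonical__measure_function_Measure mu mf.

Section mecke.
Context d (T : measurableType d) (R : realType) (P : probability T R).
Variables (Y : nat -> T -> R) (Lam : {measure set R -> \bar R}).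
Local Open Scope ereal_scope.
Hypothesis mY : forall i, measurable_fun setT (Y i).

(** [pos] makes the test functions in [laplaceY] nonnegative on the whole line, and keeps [Zi] in
    [0, 1] even on the null event where I is infinite and [Ir] is 0 by default. *)
Let pos (y : R) : R := Num.max y 0%R.
Let I w : \bar R := \sum_(i <oo) (Y i w)%:E.
Let Ir w : R := fine (I w).
Let Z w : R := expR (- Ir w).
Let Zi i w : R := expR (- pos (Ir w - Y i w)).

Hypothesis laplaceY : forall H : R -> R, measurable_fun setT H ->
  (forall y, (0 <= H y)%R) ->
  \int[P]_w expeR (- \sum_(i <oo) (H (Y i w))%:E) =
  expeR (- \int[Lam]_y (1 - expR (- H y))%:E).
Hypothesis Y_ge0 : forall i w, (0 <= Y i w)%R.
Hypothesis I_fin : {ae P, forall w, I w < +oo}.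
Hypothesis exponent_fin : forall k : nat,
  \int[Lam]_y (1 - expR (- (k%:R * pos y)))%:E < +oo.

Let mpos : measurable_fun setT pos.
Proof. exact: measurable_maxr. Qed.

Let pos_ge0 y : (0 <= pos y)%R.
Proof. by rewrite /pos le_max lexx orbT. Qed.

Let posY i w : pos (Y i w) = Y i w.
Proof. exact/max_idPl. Qed.

Let mI : measurable_fun setT I.
Proof.
apply: ge0_emeasurable_sum => [i w _ _|i _]; first by rewrite lee_fin.
by apply/measurable_EFinP.
Qed.

Let mIr : measurable_fun setT Ir.
Proof. exact: measurableT_comp. Qed.

Let mZ : measurable_fun setT Z.
Proof. by apply: measurableT_comp; [exact: measurable_expR|exact: measurable_funN]. Qed.

Let mZi i : measurable_fun setT (Zi i).
Proof.
apply: measurableT_comp; first exact: measurable_expR.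
apply: measurable_funN; apply: measurableT_comp => //; exact: measurable_funB.
Qed.

Let I_ge0 w : 0 <= I w.
Proof. by apply: nneseries_ge0 => i _ _; rewrite lee_fin. Qed.

(** * Moments of exp (- (I - Y_i)) by differentiating a Laplace functional *)

Section moment.
Variables (B : set R) (k : nat).
Hypothesis mB : measurable B.
Hypothesis LamB : Lam B < +oo.

(** The weight exp (k y) removes from exp (- k I) the contribution of the point itself: [eI * W] is
    the sum over i of 1_B(Y_i) exp (- k (I - Y_i)) whenever I is finite. *)
Let f (y : R) : R := (\1_B y * expR (k%:R * pos y))%R.
Let W w : \bar R := \sum_(i <oo) (f (Y i w))%:E.
Let eI w : \bar R := expeR (- (k%:R%:E * I w)).
Let C : \bar R := \int[Lam]_y (1 - expR (- (k%:R * pos y)))%:E.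
Let D (theta : R) : \bar R :=
  \int[Lam]_y (expR (- (k%:R * pos y)) * (1 - expR (- (theta * f y))))%:E.

Let f_ge0 y : (0 <= f y)%R. Proof. by rewrite mulr_ge0// expR_ge0. Qed.

Let mf : measurable_fun setT f.
Proof.
apply: measurable_funM; first exact: measurable_indic.
apply: measurableT_comp; first exact: measurable_expR.
exact: measurable_funM.
Qed.

Let W_ge0 w : 0 <= W w.
Proof. by apply: nneseries_ge0 => i _ _; rewrite lee_fin. Qed.

Let mW : measurable_fun setT W.
Proof.
apply: ge0_emeasurable_sum => [i w _ _|i _]; first by rewrite lee_fin.
by apply/measurable_EFinP; exact: measurableT_comp.
Qed.

Let meI : measurable_fun setT eI.
Proof.
by apply: measurableT_comp (@measurable_expeRN R) _; exact: emeasurable_funM.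
Qed.

Let eI_ge0 w : 0 <= eI w. Proof. exact: expeR_ge0. Qed.

Let eI_le1 w : eI w <= 1.
Proof. by apply: expeRN_le1; rewrite mule_ge0// lee_fin. Qed.

Let onem_ge0 (x : R) : (0 <= x -> 0 <= 1 - expR (- x))%R.
Proof. by move=> x0; rewrite subr_ge0 -expR0 ler_expR lerNl oppr0. Qed.

Let mD theta : measurable_fun setT
  (fun y => (expR (- (k%:R * pos y)) * (1 - expR (- (theta * f y))))%:E).
Proof.
apply/measurable_EFinP; apply: measurable_funM.
  apply: measurableT_comp; first exact: measurable_expR.
  by apply: measurable_funN; exact: measurable_funM.
apply: measurable_funB => //; apply: measurableT_comp; first exact: measurable_expR.
by apply: measurable_funN; exact: measurable_funM.
Qed.

Let D_ge0 theta : (0 <= theta)%R -> 0 <= D theta.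
Proof.
move=> t0; apply: integral_ge0 => y _.
by rewrite lee_fin mulr_ge0 ?expR_ge0// onem_ge0// mulr_ge0.
Qed.

(** One test function k y + theta f carries both sums, and its exponent splits as 1 - exp (- ky -
    theta f) = (1 - exp (- ky)) + exp (- ky) (1 - exp (- theta f)). *)
Let joint_laplace theta : (0 <= theta)%R ->
  \int[P]_w (eI w * expeR (- (theta%:E * W w))) = expeR (- (C + D theta)).
Proof.
move=> t0; pose H y := (k%:R * pos y + theta * f y)%R.
have H0 y : (0 <= H y)%R by rewrite addr_ge0// mulr_ge0.
have mH : measurable_fun setT H by apply: measurable_funD; exact: measurable_funM.
transitivity (\int[P]_w expeR (- \sum_(i <oo) (H (Y i w))%:E)).
  apply: eq_integral => w _; rewrite /eI -expeRD; congr expeR.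
  rewrite -oppeD ?ge0_adde_def ?inE ?mule_ge0 ?lee_fin//; congr (- _).
  have f0' i : true -> 0 <= (f (Y i w))%:E by rewrite lee_fin.
  have p0' i : true -> 0 <= (Y i w)%:E by rewrite lee_fin.
  transitivity (\sum_(i <oo) (k%:R * Y i w + theta * f (Y i w))%:E); last first.
    by apply: eq_eseriesr => i _; rewrite /H posY.
  rewrite /I /W -!nneseriesZl// -nneseriesD// => i _ _.
    by rewrite mule_ge0 ?lee_fin.
  by rewrite mule_ge0 ?lee_fin.
rewrite (laplaceY mH H0); congr (expeR (- _)).
rewrite /C /D -ge0_integralD//.
- apply: eq_integral => y _; rewrite -EFinD; congr EFin.
  by rewrite /H opprD expRD; ring.
- by move=> y _; rewrite lee_fin onem_ge0// mulr_ge0.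
- apply/measurable_EFinP; apply: measurable_funB => //.
  apply: measurableT_comp; first exact: measurable_expR.
  by apply: measurable_funN; exact: measurable_funM.
- by move=> y _; rewrite lee_fin mulr_ge0 ?expR_ge0// onem_ge0// mulr_ge0.
Qed.

Let D_quotient n y : (2 ^+ n * (expR (- (k%:R * pos y)) * (1 - expR (- (2 ^- n * f y)))))%:E =
  (expR (- (k%:R * pos y)))%:E * dyadic_quotient n (f y)%:E.
Proof. by rewrite dyadic_quotient_fin -EFinM; congr EFin; ring. Qed.

Let dE n : (2 ^+ n)%:E * D (2 ^- n) =
  \int[Lam]_y ((expR (- (k%:R * pos y)))%:E * dyadic_quotient n (f y)%:E).
Proof.
rewrite -ge0_integralZl//; last first.
  by move=> y _; rewrite lee_fin mulr_ge0 ?expR_ge0// onem_ge0// mulr_ge0// invr_ge0 exprn_ge0.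
by apply: eq_integral => y _; rewrite -EFinM D_quotient.
Qed.

Let mdq n : measurable_fun setT (fun y => (expR (- (k%:R * pos y)))%:E * dyadic_quotient n (f y)%:E).
Proof.
apply: emeasurable_funM.
  apply/measurable_EFinP; apply: measurableT_comp; first exact: measurable_expR.
  by apply: measurable_funN; exact: measurable_funM.
by apply: measurableT_comp (@measurable_dyadic_quotient R n) _; exact/measurable_EFinP.
Qed.

Let dq_ge0 n y : 0 <= (expR (- (k%:R * pos y)))%:E * dyadic_quotient n (f y)%:E.
Proof.
apply: mule_ge0; last by apply: dyadic_quotient_ge0; rewrite lee_fin.
by rewrite lee_fin expR_ge0.
Qed.

Let nd_dq y : nondecreasing_seq (fun n => (expR (- (k%:R * pos y)))%:E * dyadic_quotient n (f y)%:E).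
Proof.
move=> m n mn; rewrite lee_pmul2l ?lte_fin ?expR_gt0//.
by apply: nd_dyadic_quotient => //; rewrite lee_fin.
Qed.

(** The derivative of D at 0 is the integral of exp (- k y) f(y), in which the two exponentials
    cancel and leave the indicator of B. *)
Let cvgD : (2 ^+ n)%:E * D (2 ^- n) @[n --> \oo] --> Lam B.
Proof.
under eq_fun do rewrite dE.
have -> : Lam B = \int[Lam]_y limn (fun n => (expR (- (k%:R * pos y)))%:E * dyadic_quotient n (f y)%:E).
  rewrite -[in LHS](setIT B) -integral_indic//; apply: eq_integral => y _.
  have h : (expR (- (k%:R * pos y)))%:E * dyadic_quotient n (f y)%:E @[n --> \oo] -->
      (expR (- (k%:R * pos y)))%:E * (f y)%:E.
    by apply: cvgeZl => //; apply: cvg_dyadic_quotient_cst; rewrite lee_fin.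
  rewrite (cvg_lim _ h)// -EFinM /f; congr EFin.
  by rewrite mulrCA -expRD addNr expR0 mulr1.
apply: cvg_monotone_convergence => //.
Qed.

Let D_le n : (2 ^+ n)%:E * D (2 ^- n) <= Lam B.
Proof.
have h : nondecreasing_seq (fun n => (2 ^+ n)%:E * D (2 ^- n)).
  by move=> m m' mm'; rewrite !dE; apply: ge0_le_integral => // y _; exact: nd_dq.
rewrite -(cvg_lim _ cvgD)//; apply: (lime_ge (ereal_nondecreasing_is_cvgn h)).
by near=> m; apply: h; near: m; exists n.
Unshelve. all: by end_near. Qed.

Let C_ge0 : 0 <= C.
Proof. by apply: integral_ge0 => y _; rewrite lee_fin onem_ge0// mulr_ge0. Qed.

Let CE : C = (fine C)%:E.
Proof. by rewrite fineK// ge0_fin_numE//; exact: exponent_fin. Qed.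

Let LamBE : Lam B = (fine (Lam B))%:E.
Proof. by rewrite fineK// ge0_fin_numE. Qed.

Let DE n : D (2 ^- n) = (fine (D (2 ^- n)))%:E.
Proof.
have t0 : (0 <= 2 ^- n :> R)%R by rewrite invr_ge0 exprn_ge0.
rewrite fineK// ge0_fin_numE ?D_ge0//.
have := le_lt_trans (D_le n) LamB.
have p0 : (0 < 2 ^+ n :> R)%R by rewrite exprn_gt0.
by have := D_ge0 t0; case: (D _) => [r _ _|_|//]; [exact: ltry|rewrite gt0_muley ?lte_fin].
Qed.

Let int_eI : \int[P]_w eI w = expeR (- C).
Proof.
have := @joint_laplace 0%R (lexx _).
rewrite (_ : D 0 = 0); last first.
  by apply: integral0_eq => y _; rewrite mul0r oppr0 expR0 subrr mulr0.
rewrite adde0 => <-; apply: eq_integral => w _.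
by rewrite mul0e oppe0 expeR0 mule1.
Qed.

(** The difference quotient of theta |-> - exp (- C - D theta) at 0. Writing D(2^-n) as 2^-n (2^n
    D(2^-n)) exhibits it as a [dyadic_quotient] again, with a converging argument; finiteness of C
    and D permits the subtraction. *)
Let int_quotient n : \int[P]_w (eI w * dyadic_quotient n (W w)) =
  expeR (- C) * dyadic_quotient n ((2 ^+ n)%:E * D (2 ^- n)).
Proof.
have t0 : (0 <= 2 ^- n :> R)%R by rewrite invr_ge0 exprn_ge0.
have p0 : (0 < 2 ^+ n :> R)%R by rewrite exprn_gt0.
pose q w := 1 - expeR (- ((2 ^- n)%:E * W w)).
have tW0 w : 0 <= (2 ^- n)%:E * W w by rewrite mule_ge0// lee_fin.
have q0 w : 0 <= q w by rewrite sube_ge0 ?expeRN_le1// orbT.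
have mexp : measurable_fun setT (fun w => expeR (- ((2 ^- n)%:E * W w))).
  by apply: measurableT_comp (@measurable_expeRN R) _; exact: emeasurable_funM.
have mq : measurable_fun setT q by exact: emeasurable_funB.
have E1 : \int[P]_w (eI w * q w) + expeR (- (C + D (2 ^- n))) = expeR (- C).
  rewrite -int_eI -joint_laplace// -ge0_integralD//.
  - apply: eq_integral => w _; rewrite -ge0_muleDr ?expeR_ge0// subeK ?mule1//.
    by rewrite ge0_fin_numE ?expeR_ge0// (le_lt_trans (expeRN_le1 (tW0 w)))// ltry.
  - by move=> w _; rewrite mule_ge0.
  - exact: emeasurable_funM.
  - by move=> w _; rewrite mule_ge0// expeR_ge0.
  - exact: emeasurable_funM.
transitivity ((2 ^+ n)%:E * \int[P]_w (eI w * q w)).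
  rewrite -ge0_integralZl//; last 2 first.
  - exact: emeasurable_funM.
  - by move=> w _; rewrite mule_ge0.
  by apply: eq_integral => w _; rewrite /dyadic_quotient muleCA.
have -> : \int[P]_w (eI w * q w) = expeR (- C) * (1 - expeR (- D (2 ^- n))).
  have bfin : expeR (- (C + D (2 ^- n))) \is a fin_num by rewrite CE DE.
  rewrite -[LHS](addeK _ bfin) E1 CE DE -EFinD /= -EFinB -EFinM; congr EFin.
  by rewrite opprD expRD; ring.
rewrite muleCA; congr (_ * (_ * (_ - expeR (- _)))).
by rewrite muleA -EFinM mulVf ?mul1e// gt_eqF.
Qed.

(** Both sides are limits of the quotients in [int_quotient]: the left one by monotone convergence,
    the right one by [cvgD]. *)
Let int_eIW : \int[P]_w (eI w * W w) = \int[P]_w eI w * Lam B.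
Proof.
have l1 : \int[P]_w (eI w * dyadic_quotient n (W w)) @[n --> \oo] --> \int[P]_w (eI w * W w).
  rewrite (_ : (fun w => eI w * W w) = fun w => limn (fun n => eI w * dyadic_quotient n (W w))).
    apply: cvg_monotone_convergence => //.
    - move=> n; apply: emeasurable_funM => //.
      exact: measurableT_comp (@measurable_dyadic_quotient R n) _.
    - by move=> n w _; rewrite mule_ge0// dyadic_quotient_ge0.
    - move=> w _ m n mn; apply: lee_wpmul2l => //; exact: nd_dyadic_quotient.
  apply/funext => w; apply/esym/cvg_lim => //; apply: cvgeZl.
    by rewrite ge0_fin_numE// (le_lt_trans (eI_le1 w))// ltry.
  exact: cvg_dyadic_quotient_cst.
suff l2 : \int[P]_w (eI w * dyadic_quotient n (W w)) @[n --> \oo] --> \int[P]_w eI w * Lam B.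
  exact: (cvg_unique _ l1 l2).
under eq_fun do rewrite int_quotient.
rewrite int_eI; apply: cvgeZl; first by rewrite CE.
apply: cvg_dyadic_quotient => //.
- by move=> n; rewrite mule_ge0 ?lee_fin ?exprn_ge0// D_ge0// invr_ge0 exprn_ge0.
- by left; rewrite LamBE.
Qed.
Lemma mecke_moment : \sum_(i <oo) \int[P]_(w in Y i @^-1` B) (Zi i w ^+ k)%:E =
  Lam B * \int[P]_w (Z w ^+ k)%:E.
Proof.
have Z0 i w : (0 <= Zi i w ^+ k)%R by rewrite exprn_ge0// expR_ge0.
have mZk i : measurable_fun setT (fun w => (Zi i w ^+ k)%:E).
  by apply/measurable_EFinP; exact: measurable_funX.
have mBY i : measurable_fun setT (fun w => (\1_B (Y i w))%:E : \bar R).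
  by apply/measurable_EFinP; exact: measurableT_comp (measurable_indic mB) _.
have YmB i : measurable (Y i @^-1` B) by rewrite -[X in measurable X]setTI; exact: mY.
transitivity (\int[P]_w \sum_(i <oo) ((\1_B (Y i w))%:E * (Zi i w ^+ k)%:E)).
  rewrite integral_nneseries//; last 2 first.
  - by move=> i; exact: emeasurable_funM.
  - by move=> i w _; rewrite mule_ge0 ?lee_fin.
  apply: eq_eseriesr => i _; rewrite [LHS]integral_mkcond; apply: eq_integral => w _.
  rewrite patchE -EFinM indicE.
  have [h|h] := pselect (B (Y i w)).
    by rewrite !mem_set// mul1r.
  by rewrite !memNset// mul0r.
transitivity (\int[P]_w (eI w * W w)).
  apply: ge0_ae_eq_integral => //.
  - apply: ge0_emeasurable_sum => [i w _ _|i _]; first by rewrite mule_ge0 ?lee_fin.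
    exact: emeasurable_funM.
  - exact: emeasurable_funM.
  - by move=> w _; apply: nneseries_ge0 => i _ _; rewrite mule_ge0 ?lee_fin.
  - by move=> w _; rewrite mule_ge0.
  apply: filterS I_fin => w Iw _.
  have IE : I w = (Ir w)%:E by rewrite fineK// ge0_fin_numE.
  rewrite /eI IE /= /W -nneseriesZl//; last by move=> i _; rewrite lee_fin.
  apply: eq_eseriesr => i _; rewrite -!EFinM; congr EFin; rewrite /f mulrCA; congr (_ * _)%R.
  have YI : (Y i w <= Ir w)%R.
    rewrite -lee_fin -IE; apply: le_trans (nneseries_lim_ge i.+1 _); last by move=> n _ _; rewrite lee_fin.
    by rewrite big_mkord big_ord_recr/= leeDr// sume_ge0// => j _; rewrite lee_fin.
  have -> : Zi i w = expR (- (Ir w - Y i w)).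
    by rewrite /Zi; congr (expR (- _)); apply/max_idPl; rewrite subr_ge0.
  by rewrite -expRM_natl -expRD posY; congr expR; ring.
rewrite int_eIW muleC; congr (_ * _).
apply: ge0_ae_eq_integral => //.
- by apply/measurable_EFinP; exact: measurable_funX.
- by move=> w _; rewrite lee_fin exprn_ge0// expR_ge0.
apply: filterS I_fin => w Iw _.
have IE : I w = (Ir w)%:E by rewrite fineK// ge0_fin_numE.
by rewrite /eI IE /= /Z -expRM_natl mulrN.
Qed.

End moment.

Let Z_itv w : (`[0%R, 1%R]%classic : set R) (Z w).
Proof.
rewrite /= in_itv/= expR_ge0/= -expR0 ler_expR lerNl oppr0.
exact/fine_ge0/I_ge0.
Qed.

Let Zi_itv i w : (`[0%R, 1%R]%classic : set R) (Zi i w).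
Proof. by rewrite /= in_itv/= expR_ge0/= -expR0 ler_expR lerNl oppr0. Qed.

Let YB i B : measurable B -> measurable (Y i @^-1` B).
Proof. by move=> mB; rewrite -[X in measurable X]setTI; exact: mY. Qed.

(** For fixed [B] both sides are measures in [A] carried by [0, 1], and [mecke_moment] says that
    their moments agree. *)
Let mecke_rect (B A : set R) : measurable B -> Lam B < +oo -> measurable A ->
  \sum_(i <oo) P (Zi i @^-1` A `&` Y i @^-1` B) = Lam B * P (Z @^-1` A).
Proof.
move=> mB LB mA.
pose k_ i := image_measure (mrestr P (YB i mB)) (mZi i).
pose mu : {measure set R -> \bar R} := mseries k_ 0.
pose c : {nonneg R} := NngNum (fine_ge0 (measure_ge0 Lam B)).
pose nu : {measure set R -> \bar R} := mscale c (image_measure P mZ).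
have cE : Lam B = c%:num%:E by rewrite /= fineK// ge0_fin_numE.
have mD : measurable (`[0%R, 1%R]%classic : set R) by exact: measurable_itv.
have mX k : measurable_fun (`[0%R, 1%R]%classic : set R) (fun u : R => (u ^+ k)%:E).
  apply/measurable_EFinP; exact: exprn_measurable.
have X0 k (u : R) : (`[0%R, 1%R]%classic : set R) u -> 0 <= (u ^+ k)%:E.
  by rewrite /= in_itv/= => /andP[u0 _]; rewrite lee_fin exprn_ge0.
have momE k : \int[mu]_(u in `[0%R, 1%R]%classic) (u ^+ k)%:E = \int[nu]_(u in `[0%R, 1%R]%classic) (u ^+ k)%:E.
  rewrite ge0_integral_measure_series//; last exact: X0.
  rewrite ge0_integral_mscale//; last exact: X0.
  rewrite ge0_integral_pushforward//; last by move=> u; rewrite inE; exact: X0.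
  transitivity (\sum_(i <oo) \int[P]_(w in Y i @^-1` B) (Zi i w ^+ k)%:E).
    apply: eq_eseriesr => i _.
    rewrite ge0_integral_pushforward//; last by move=> u; rewrite inE; exact: X0.
    rewrite (_ : Zi i @^-1` _ = setT); last by apply/seteqP; split => // w _; exact: Zi_itv.
    rewrite ge0_integral_mrestr//.
    - by apply/measurable_EFinP; exact: measurable_funX.
    - by move=> w; rewrite lee_fin exprn_ge0// expR_ge0.
  rewrite mecke_moment// cE; congr (_ * _).
  by rewrite (_ : Z @^-1` _ = setT)//; apply/seteqP; split => // w _; exact: Z_itv.
have nuT : nu setT < +oo.
  by rewrite /nu/= /mscale/= /pushforward preimage_setT probability_setT mule1 ltry.
(* The total mass is the moment of order 0. *)
have muT : mu setT < +oo.
  rewrite (_ : mu setT = Lam B * P setT) ?probability_setT ?mule1//.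
  transitivity (\sum_(i <oo) \int[P]_(w in Y i @^-1` B) (Zi i w ^+ 0)%:E).
    apply: eq_eseriesr => i _; rewrite /k_ /= /pushforward /mrestr preimage_setT setTI.
    by under eq_integral do rewrite expr0; rewrite integral_cst ?mul1e//; exact: YB.
  rewrite mecke_moment//; under eq_integral do rewrite expr0.
  by rewrite (integral_cst P measurableT 1) mul1e [X in _ * X](@probability_setT _ _ _ P) mule1.
have := moments_unique muT nuT _ _ momE mA.
rewrite /mu /nu/= /mscale /mseries/= cE; apply.
- rewrite /mu /= /mseries eseries0// => i _ _; rewrite /k_ /= /pushforward /mrestr.
  by rewrite (_ : Zi i @^-1` _ = set0) ?set0I ?measure0//; apply/seteqP; split => // w /=; apply; exact: Zi_itv.
- rewrite /nu /= /mscale /pushforward (_ : Z @^-1` _ = set0) ?measure0 ?mule0//.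
  by apply/seteqP; split => // w /=; apply; exact: Z_itv.
Qed.

(* Only the law of the pair (Y_i, Z_i) enters, and the law of Z_i, being carried
   by [0, 1], is determined by its moments. *)
Lemma reduced_mecke (D : set R) (G : set (R * R)) :
  measurable D -> Lam D < +oo -> measurable G ->
  \sum_(i <oo) P [set w | D (Y i w) /\ G (Y i w, pos (Ir w - Y i w))] =
  \int[P]_w Lam (D `&` [set y | G (y, Ir w)]).
Proof.
move=> mD LD mG.
(* [G] is transported through z = exp (- x), because the measure comparison is available for the
   variables exp (- x). *)
pose G' : set (R * R) := [set z | G (z.1, (- ln z.2)%R)].
have mG' : measurable G'.
  rewrite -[G']setTI.
  have h : measurable_fun setT (fun z : R * R => (z.1, (- ln z.2)%R)).
    apply: measurable_fun_pair => //.
    apply: (@measurable_funN _ _ _ _ (fun z : R * R => ln z.2)).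
    by apply: measurableT_comp => //; exact: measurable_ln.
  exact: h.
pose m1 : {sigma_finite_measure set R -> \bar R} := mfrestr mD LD.
pose Zm : {mfun T >-> R} := HB.pack Z (isMeasurableFun.Build _ _ _ _ _ mZ).
pose m2 : probability R R := distribution P Zm.
have mYZ i : measurable_fun setT (fun w => (Y i w, Zi i w)).
  exact: measurable_fun_pair.
pose m' : {measure set (R * R) -> \bar R} :=
  mseries (fun i => image_measure (mrestr P (YB i mD)) (mYZ i)) 0.
have mE A B : measurable A -> measurable B -> m' (A `*` B) = m1 A * m2 B.
  move=> mA mB; rewrite /m1 /m2 /m' /= /mseries /mfrestr /mrestr.
  rewrite -[X in _ = _ * X]/(P (Z @^-1` B)) -mecke_rect//; last 2 first.
  - exact: measurableI.
  - by apply: (le_lt_trans _ LD); apply: le_measure; rewrite ?inE//; exact: measurableI.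
  apply: eq_eseriesr => i _; rewrite /pushforward /=; congr (P _).
  by apply/seteqP; split => w /=; [move=> [[? ?] ?]|move=> [? [? ?]]].
(* Agreement on rectangles, which is [mecke_rect], determines the joint measure as a product. *)
have := @product_measure_unique _ _ _ _ R m1 m2 m' mE G' mG'.
rewrite (product_measure2_eq m1 m2 mG').
have mys : measurable_fun setT (m1 \o ysection G').
  exact: (@measurable_fun_ysection _ _ _ _ R m1 G' mG').
rewrite (ge0_integral_distribution Zm mys) => [|y]; last exact: measure_ge0.
move=> /= h.
transitivity (m' G').
  apply: eq_eseriesr => i _; rewrite /= /pushforward /mrestr; congr (P _).
  apply/seteqP; split => w /=; rewrite /G' /= /Zi expRK opprK; first by move=> [].
  by move=> [].
apply: (etrans (esym h)); apply: eq_integral => w _; rewrite /mfrestr /mrestr setIC; congr (Lam (_ `&` _)).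
by apply/seteqP; split => y /=; rewrite /ysection /= inE /G' /= /Z expRK opprK.
Qed.

End mecke.

(** * Shot noise with a power-law intensity *)

Lemma Gamma_gt0 (R : realType) (x : R) : 0 < x <= 2 -> 0 < Gamma x.
Proof.
move=> x02; rewrite -lte_fin -GammaE//.
have mf (D : set R) : measurable_fun D (fun u => (u `^ (x - 1) * expR (- u))%:E).
  apply/measurable_EFinP/measurable_funTS; apply: measurable_funM; first exact: measurable_powR.
  by apply: measurableT_comp; [exact: measurable_expR|exact: measurable_funN].
(* On [1, 2], u^(x-1) >= 1/u >= 1/2 and exp (- u) >= exp (- 2). *)
apply: (@lt_le_trans _ _ (\int[lebesgue_measure]_(u in `[1%R, 2%R]) ((2^-1 * expR (- 2))%:E))%E).
  rewrite integral_cst//= lebesgue_measure_itv/= lte_fin ltr1n -EFinB -EFinM lte_fin.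
  by rewrite !mulr_gt0 ?expR_gt0//; lra.
apply: (@le_trans _ _ (\int[lebesgue_measure]_(u in `[1%R, 2%R]) (u `^ (x - 1) * expR (- u))%:E)%E).
  apply: ge0_le_integral => //.
  - exact: mf.
  - move=> u; rewrite /= in_itv/= => /andP[u1 u2]; rewrite lee_fin.
    apply: ler_pM; rewrite ?expR_ge0//; last by rewrite ler_expR lerN2.
    have u0 : 0 < u by lra.
    apply: (@le_trans _ _ (u `^ (- 1))); last by apply: ler_powR => //; lra.
    by rewrite powR_inv1 ?(ltW u0)// lef_pV2// posrE.
apply: ge0_subset_integral => //.
- exact: mf.
- by move=> u _; rewrite lee_fin mulr_ge0 ?powR_ge0// expR_ge0.
- by move=> u /=; rewrite !in_itv/= => /andP[u1 _]; rewrite andbT; lra.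
Qed.

Section power_law_shot_noise.
Context d (T : measurableType d) (R : realType) (P : probability T R).
Variables (Y : nat -> T -> R) (Lam : {measure set R -> \bar R}) (a alpha g : R).
Local Open Scope ereal_scope.

Let pos (y : R) : R := Num.max y 0%R.
Let I w : \bar R := \sum_(i <oo) (Y i w)%:E.
Let Ir w : R := fine (I w).

Hypothesis mY : forall i, measurable_fun setT (Y i).
Hypothesis laplaceY : forall H : R -> R, measurable_fun setT H ->
  (forall y, (0 <= H y)%R) ->
  \int[P]_w expeR (- \sum_(i <oo) (H (Y i w))%:E) =
  expeR (- \int[Lam]_y (1 - expR (- H y))%:E).
Hypothesis Y_ge0 : forall i w, (0 <= Y i w)%R.
Hypothesis Y_gt0 : {ae P, forall w, forall i, (0 < Y i w)%R}.
Hypotheses (a_gt0 : (0 < a)%R) (alpha_gt0 : (0 < alpha)%R).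
Hypothesis LamE : forall u, (0 < u)%R -> Lam `[u, +oo[%classic = (a * u `^ (- alpha))%:E.
Hypothesis exponentE : forall z, (0 < z)%R ->
  \int[Lam]_y (1 - expR (- (z * pos y)))%:E = (a * z `^ alpha * g)%:E.

Let mpos : measurable_fun setT pos. Proof. exact: measurable_maxr. Qed.

Let pos_ge0 y : (0 <= pos y)%R.
Proof. by rewrite /pos le_max lexx orbT. Qed.

Let posY i w : pos (Y i w) = Y i w. Proof. exact/max_idPl. Qed.

Let I_ge0 w : 0 <= I w.
Proof. by apply: nneseries_ge0 => i _ _; rewrite lee_fin. Qed.

Let mI : measurable_fun setT I.
Proof.
apply: ge0_emeasurable_sum => [i w _ _|i _]; first by rewrite lee_fin.
by apply/measurable_EFinP.
Qed.

Let mIr : measurable_fun setT Ir. Proof. exact: measurableT_comp. Qed.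

Lemma laplace_shot_noise z : (0 <= z)%R ->
  \int[P]_w expeR (- (z%:E * I w)) = (expR (- (a * z `^ alpha * g)))%:E.
Proof.
rewrite le_eqVlt => /predU1P[<-|z0].
  rewrite powR0 ?gt_eqF// mulr0 mul0r oppr0 expR0.
  under eq_integral do rewrite mul0e oppe0 expeR0.
  by rewrite (integral_cst P measurableT 1) mul1e [LHS](@probability_setT _ _ _ P).
have H0 y : (0 <= z * pos y)%R by rewrite mulr_ge0// ltW.
have mH : measurable_fun setT (fun y => z * pos y)%R by exact: measurable_funM.
have := laplaceY mH H0; rewrite exponentE//= => <-.
apply: eq_integral => w _; congr (expeR (- _)).
rewrite -nneseriesZl//; last by move=> i _; rewrite lee_fin.
by apply: eq_eseriesr => i _; rewrite posY.
Qed.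

Let g_ge0 : (0 <= g)%R.
Proof.
have : 0 <= \int[Lam]_y (1 - expR (- (1 * pos y)))%:E.
  apply: integral_ge0 => y _; rewrite mul1r lee_fin subr_ge0 -[leRHS]expR0.
  by rewrite ler_expR lerNl oppr0.
by rewrite exponentE// lee_fin powR1 mulr1 pmulr_rge0.
Qed.

(** For z > 0, exp (- z I) is at most the indicator of I < +oo, while its expectation is at least 1
    - a z^alpha g, which tends to 1 as z tends to 0. *)
Lemma shot_noise_fin : {ae P, forall w, I w < +oo}.
Proof.
pose F := [set w | I w < +oo].
have mF : measurable F.
  rewrite (_ : F = [set: T] `&` [set w | I w < +oo]); last by rewrite setTI.
  exact: emeasurable_fun_infty_o.
have PF e : (0 < e)%R -> (1 - a * e * g)%:E <= P F.
  move=> e0; pose z := (e `^ alpha^-1)%R.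
  have zE : (z `^ alpha = e)%R.
    by rewrite /z -powRrM mulVf ?gt_eqF// powRr1// ltW.
  have := @laplace_shot_noise z (powR_ge0 _ _); rewrite zE => h.
  apply: (@le_trans _ _ (\int[P]_w expeR (- (z%:E * I w)))).
    by rewrite h lee_fin; exact: expR_ge1Dx.
  rewrite -(setIT F) -(integral_indic P measurableT mF).
  apply: ge0_le_integral => //.
  - by move=> w _; exact: expeR_ge0.
  - apply: measurableT_comp (@measurable_expeRN R) _; exact: emeasurable_funM.
  - by apply/measurable_EFinP; exact: measurable_indic.
  - move=> w _; rewrite indicE; have [wF|wF] := boolP (w \in F).
      by apply: expeRN_le1; rewrite mule_ge0// lee_fin powR_ge0.
    have -> : I w = +oo.
      apply/eqP; rewrite -leye_eq leNgt; apply: contra wF => h'; exact: mem_set.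
    by rewrite gt0_muley ?lte_fin ?powR_gt0.
have PF1 : P F = 1.
  apply/eqP; rewrite eq_le probability_le1//=.
  have Pfin : P F \is a fin_num by exact: fin_num_measure.
  rewrite -(fineK Pfin) lee_fin; apply/ler_addgt0Pl => e e0.
  have ag : (0 <= a * g)%R by rewrite mulr_ge0// ltW.
  have ag1 : (0 < a * g + 1)%R by lra.
  (* The summand 1 keeps the denominator positive, g being known only to be nonnegative. *)
  have := PF (e / (a * g + 1))%R (divr_gt0 e0 ag1).
  rewrite -(fineK Pfin) lee_fin => h.
  have : (a * (e / (a * g + 1)) * g <= e)%R.
    by rewrite mulrAC mulrA ler_pdivrMr// mulrC ler_pM2l// lerDl.
  lra.
have : P (~` F) = 0.
  by rewrite probability_setC// PF1 subee.
move=> h; exists (~` F); split => //; first exact: measurableC.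
Qed.
Lemma shot_noise_gt0 : {ae P, forall w, (0 < Ir w)%R}.
Proof.
apply: filterS2 Y_gt0 shot_noise_fin => w Yw Iw.
rewrite fine_gt0// Iw andbT; apply: (@lt_le_trans _ _ (Y 0%N w)%:E); first by rewrite lte_fin.
apply: le_trans (nneseries_lim_ge 1 _); last by move=> n _ _; rewrite lee_fin.
by rewrite big_nat1.
Qed.

Section coverage.
Variables (N t : R).
Hypotheses (N_ge0 : (0 <= N)%R) (t_gt0 : (0 < t)%R).

Let v n : R := n.+1%:R^-1.
Let c w : R := (t * (N + Ir w))%R.

Let v_gt0 n : (0 < v n)%R. Proof. by rewrite invr_gt0. Qed.

(** [reduced_mecke] requires finite mass, hence the cut-off at [v n]. The remaining set is the
    half-line from max (v n) (c w), whose mass [LamE] gives. *)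
Let sum_cutoff n :
  \sum_(i <oo) P [set w | `[v n, +oo[%classic (Y i w) /\
    (t * (N + pos (Ir w - Y i w)) <= Y i w)%R] =
  \int[P]_w (a * (Num.max (v n) (c w)) `^ (- alpha))%:E.
Proof.
pose G := [set z : R * R | (t * (N + z.2) <= z.1)%R].
have mG : measurable G.
  apply: measurable_is_true; apply: measurable_fun_ler => //.
  by apply: measurable_funM => //; exact: measurable_funD.
have LD : Lam `[v n, +oo[%classic < +oo by rewrite LamE// ltry.
have ef (k : nat) : \int[Lam]_y (1 - expR (- (k%:R * pos y)))%:E < +oo.
  case: k => [|k]; last by rewrite exponentE// ltry.
  rewrite integral0_eq// => y _; by rewrite mul0r oppr0 expR0 subrr.
rewrite (reduced_mecke mY laplaceY Y_ge0 shot_noise_fin ef (measurable_itv _) LD mG).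
apply: eq_integral => w _; rewrite -LamE ?lt_max ?v_gt0//; congr (Lam _).
by apply/seteqP; split => y /=; rewrite !in_itv/= !andbT ge_max; [move=> [-> h]|move=> /andP[-> h]].
Qed.

Let mcut n : measurable_fun setT (fun w => (a * (Num.max (v n) (c w)) `^ (- alpha))%:E).
Proof.
apply/measurable_EFinP; apply: measurable_funM => //.
apply: (measurableT_comp (@measurable_powR R (- alpha)%R)).
apply: measurable_maxr => //; apply: measurable_funM => //; exact: measurable_funD.
Qed.

Lemma sum_coverage :
  \sum_(i <oo) P [set w | (0 < Y i w)%R /\ (t * (N + pos (Ir w - Y i w)) <= Y i w)%R] =
  \int[P]_w (a * (t * (N + Ir w)) `^ (- alpha))%:E.
Proof.
pose E n i := [set w | `[v n, +oo[%classic (Y i w) /\ (t * (N + pos (Ir w - Y i w)) <= Y i w)%R].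
have vnd m n : (m <= n)%N -> (v n <= v m)%R.
  by move=> mn; rewrite lef_pV2 ?posrE// ler_nat.
have mE n i : measurable (E n i).
  apply: measurableI.
    by rewrite -[X in measurable X]setTI; exact: mY.
  apply: measurable_is_true; apply: measurable_fun_ler => //.
  apply: measurable_funM => //; apply: measurable_funD => //.
  by apply: measurableT_comp => //; exact: measurable_funB.
have ndE i : nondecreasing_seq (E ^~ i).
  move=> m n mn; apply/subsetPset => w; rewrite /E /= !in_itv/= !andbT => -[h1 h2].
  by split => //; exact: le_trans (vnd _ _ mn) h1.
have EU i : \bigcup_n E n i =
    [set w | (0 < Y i w)%R /\ (t * (N + pos (Ir w - Y i w)) <= Y i w)%R].
  apply/seteqP; split => w /=.
    move=> [n _]; rewrite /E /= !in_itv/= !andbT => -[h1 h2].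
    by split => //; exact: lt_le_trans h1.
  move=> [Y0 h]; exists (Num.truncn (Y i w)^-1) => //; split => //=.
  rewrite /E /= in_itv/= andbT /v -[leRHS]invrK lef_pV2 ?posrE ?invr_gt0//.
  by apply/ltW; rewrite truncnS_gt.
have ndcut w : nondecreasing_seq (fun n => (a * (Num.max (v n) (c w)) `^ (- alpha))%:E).
  move=> m n mn; rewrite -!LamE ?lt_max ?v_gt0//.
  apply: le_measure; rewrite ?inE//.
  move=> y /=; rewrite !in_itv/= !andbT !ge_max => /andP[h1 ->].
  by rewrite andbT (le_trans (vnd _ _ mn)).
have l1 : \sum_(i <oo) P (E n i) @[n --> \oo] --> \sum_(i <oo) P (\bigcup_n E n i).
  apply: cvg_nneseries_nd => //.
    move=> i m n mn; apply: le_measure; rewrite ?inE//; exact/subsetPset/ndE.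
  move=> i; apply: nondecreasing_cvg_mu => //; exact: bigcup_measurable.
have l2 : \sum_(i <oo) P (E n i) @[n --> \oo] -->
    \int[P]_w (a * (t * (N + Ir w)) `^ (- alpha))%:E.
  rewrite (_ : (fun n => _) = fun n => \int[P]_w (a * (Num.max (v n) (c w)) `^ (- alpha))%:E).
    rewrite (_ : \int[P]_w _ = \int[P]_w limn (fun n => (a * (Num.max (v n) (c w)) `^ (- alpha))%:E)).
      apply: cvg_monotone_convergence => //.
      by move=> n w _; rewrite lee_fin mulr_ge0 ?powR_ge0// ltW.
    have tgt_ge0 w : 0 <= (a * (t * (N + Ir w)) `^ (- alpha))%:E.
      by rewrite lee_fin mulr_ge0 ?powR_ge0// ltW.
    apply: ge0_ae_eq_integral => //.
    - apply/measurable_EFinP; apply: measurable_funM => //.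
      apply: (measurableT_comp (@measurable_powR R (- alpha)%R)).
      by apply: measurable_funM => //; exact: measurable_funD.
    - apply: measurable_limn => n; exact: mcut.
    - move=> w _; apply: lime_ge.
        by apply: ereal_nondecreasing_is_cvgn; exact: ndcut.
      by apply: nearW => n; rewrite lee_fin mulr_ge0 ?powR_ge0// ltW.
    (* Almost surely [Ir w] > 0, so [c w] > 0 even when N = 0, and the maximum equals [c w] for
       large n. At [c w] = 0 the limit would be infinite whereas [powR] returns 0. *)
    apply: filterS shot_noise_gt0 => w Iw _; apply/esym/cvg_lim => //.
    apply: cvg_near_cst.
    have c0 : (0 < c w)%R by rewrite mulr_gt0// ltr_wpDl.
    near=> n; rewrite max_r//.
    have : (v n < c w)%R by near: n; exact: near_infty_natSinv_lt (PosNum c0).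
    exact: ltW.
  by apply/funext => n; exact: sum_cutoff.
rewrite -(cvg_unique _ l1 l2)//; apply: eq_eseriesr => i _; by rewrite EU.
Unshelve. all: by end_near. Qed.

End coverage.

Section coverage_integral.
Variables (N t beta : R).
Hypotheses (N_ge0 : (0 <= N)%R) (t_gt0 : (0 < t)%R) (beta_ge2 : (2 <= beta)%R).
Hypothesis alphaE : alpha = (2 / beta)%R.

(** Chosen so that c^(-alpha) = a: the factor a is absorbed in the power, and the Laplace exponent a
    (c r^beta)^alpha g collapses to r^2 g. *)
Let c : R := (a `^ (- (beta / 2)))%R.

Let beta_gt0 : (0 < beta)%R. Proof. by apply: lt_le_trans beta_ge2. Qed.

Let c_gt0 : (0 < c)%R. Proof. exact: powR_gt0. Qed.

Let cE : (c `^ (- alpha) = a)%R.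
Proof.
rewrite /c -powRrM mulrNN alphaE (_ : (_ * _ = 1)%R) ?powRr1 1?ltW//.
by field; rewrite gt_eqF.
Qed.

Let laplace_Ir z : (0 <= z)%R ->
  \int[P]_w (expR (- (z * Ir w)))%:E = (expR (- (a * z `^ alpha * g)))%:E.
Proof.
move=> z0; rewrite -laplace_shot_noise//; apply: ge0_ae_eq_integral => //.
- apply/measurable_EFinP; apply: measurableT_comp; first exact: measurable_expR.
  by apply: measurable_funN; exact: measurable_funM.
- by apply: measurableT_comp (@measurable_expeRN R) _; exact: emeasurable_funM.
- by move=> w _; exact: expeR_ge0.
apply: filterS shot_noise_fin => w Iw _.
have -> : I w = (Ir w)%:E by rewrite fineK// ge0_fin_numE.
by rewrite -EFinM.
Qed.

(** [integral_expRN_powR] at y = c (N + Ir) linearizes the negative power; Tonelli then brings the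
    expectation inside, where it is the Laplace transform of the shot noise at c r^beta. *)
Lemma coverage_integral :
  \int[P]_w (a * (t * (N + Ir w)) `^ (- alpha))%:E =
  (2 * t `^ (- alpha) / Gamma (1 + alpha))%R%:E *
  \int[lebesgue_measure]_(r in `[0%R, +oo[)
    (r * expR (- (r ^+ 2 * g) - N * c * r `^ beta))%R%:E.
Proof.
have Gamma1 : (0 < Gamma (1 + alpha))%R.
  apply: Gamma_gt0; rewrite addr_gt0//= -[2%:R]/(1 + 1)%R lerD2l alphaE ler_pdivrMr//.
  by rewrite mul1r.
pose h (r : R) := (r * expR (- (r ^+ 2 * g) - N * c * r `^ beta))%R.
have mpow : measurable_fun setT (fun r : R => r `^ beta)%R by exact: measurable_powR.
have mh : measurable_fun setT h.
  apply: measurable_funM => //; apply: measurableT_comp; first exact: measurable_expR.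
  apply: measurable_funB; last exact: measurable_funM.
  by apply: measurable_funN; apply: measurable_funM => //; exact: exprn_measurable.
pose F (p : T * measurableTypeR R) : \bar R :=
  (\1_`[0%R, +oo[%classic p.2 * (2 * p.2 * expR (- (c * (N + Ir p.1) * p.2 `^ beta))))%:E.
have F0 p : 0 <= F p.
  rewrite lee_fin indicE; case: (boolP (_ \in _)); rewrite ?mul0r// inE/= in_itv/= andbT => p0.
  by rewrite mul1r !mulr_ge0// expR_ge0.
have mF : measurable_fun setT F.
  apply/measurable_EFinP; apply: measurable_funM.
    by apply: (measurableT_comp (measurable_indic _)) => //; exact: measurable_itv.
  apply: measurable_funM; first exact: measurable_funM.
  apply: measurableT_comp; first exact: measurable_expR.
  apply: measurable_funN; apply: measurable_funM.
    apply: measurable_funM => //; apply: measurable_funD => //.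
    exact: (measurableT_comp mIr).
  exact: (measurableT_comp mpow).
have Iy w : (0 < Ir w)%R -> (a * (t * (N + Ir w)) `^ (- alpha))%:E =
   (t `^ (- alpha) / Gamma (1 + alpha))%:E * \int[lebesgue_measure]_r F (w, r).
  move=> I0; have NI : (0 < N + Ir w)%R by rewrite ltr_wpDl.
  have y0 : (0 < c * (N + Ir w))%R by rewrite mulr_gt0.
  have -> : \int[lebesgue_measure]_r F (w, r) =
      \int[lebesgue_measure]_(r in `[0%R, +oo[) (2 * r * expR (- (c * (N + Ir w) * r `^ beta)))%:E.
    rewrite [RHS]integral_mkcond; apply: eq_integral => r _.
    by rewrite patchE /F indicE /=; case: ifPn => _; rewrite ?mul1r ?mul0r.
  rewrite integral_expRN_powR// -EFinM; congr EFin.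
  rewrite -alphaE !powRM ?(ltW c_gt0) ?(ltW NI) ?(ltW t_gt0) ?mulr_ge0 ?ltW// cE.
  field; exact: lt0r_neq0.
pose C := (t `^ (- alpha) / Gamma (1 + alpha))%R.
have C0 : (0 <= C)%R by rewrite divr_ge0 ?powR_ge0// ltW.
have mG : measurable_fun setT (fun w => \int[lebesgue_measure]_r F (w, r)).
  exact: (@measurable_fun_fubini_tonelli_F _ _ _ _ R lebesgue_measure F mF F0).
have G0 w : 0 <= \int[lebesgue_measure]_r F (w, r) by exact: integral_ge0.
transitivity (\int[P]_w (C%:E * \int[lebesgue_measure]_r F (w, r))).
  apply: ge0_ae_eq_integral => //.
  - apply/measurable_EFinP; apply: measurable_funM => //.
    apply: (measurableT_comp (@measurable_powR R (- alpha)%R)).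
    by apply: measurable_funM => //; exact: measurable_funD.
  - exact: emeasurable_funM.
  - by move=> w _; rewrite lee_fin mulr_ge0 ?powR_ge0// ltW.
  - by move=> w _; rewrite mule_ge0.
  by apply: filterS shot_noise_gt0 => w I0 _; exact: Iy.
rewrite ge0_integralZl//.
rewrite (fubini_tonelli F mF F0) /=.
transitivity (C%:E * \int[lebesgue_measure]_(r in `[0%R, +oo[) (2%:E * (h r)%:E)).
  congr (_ * _); rewrite [RHS]integral_mkcond; apply: eq_integral => r _.
  rewrite patchE; case: ifPn => r0; last first.
    by rewrite integral0_eq// => w _; rewrite /F indicE/= (negbTE r0) mul0r.
  have FE w : F (w, r) = (2 * r * expR (- (c * (N + Ir w) * r `^ beta)))%:E.
    by rewrite /F indicE/= r0 mul1r.
  have {}r0 : (0 <= r)%R by move: r0; rewrite inE/= in_itv/= andbT.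
  have z0 : (0 <= c * r `^ beta)%R by rewrite mulr_ge0 ?powR_ge0// ltW.
  transitivity (\int[P]_w ((2 * r * expR (- (N * c * r `^ beta)))%:E * (expR (- (c * r `^ beta * Ir w)))%:E)).
    apply: eq_integral => w _; rewrite FE -EFinM; congr EFin; rewrite -[RHS]mulrA -expRD.
    by congr (_ * expR _)%R; ring.
  rewrite ge0_integralZl//; last 2 first.
  - apply/measurable_EFinP; apply: measurableT_comp; first exact: measurable_expR.
    by apply: measurable_funN; exact: measurable_funM.
  - by rewrite lee_fin !mulr_ge0// expR_ge0.
  rewrite laplace_Ir// -!EFinM; congr EFin; rewrite /h -!mulrA -expRD; congr (2 * (r * expR _))%R.
  have -> : ((c * r `^ beta) `^ alpha = a^-1 * r ^+ 2)%R.
    rewrite powRM ?powR_ge0// ?ltW// -powRrM -cE powRN invrK; congr (_ * _)%R.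
    rewrite -powR_mulrn//; congr (_ `^ _)%R; rewrite alphaE; field; exact: lt0r_neq0.
  by field; exact: lt0r_neq0.
have -> : \int[lebesgue_measure]_(r in `[0%R, +oo[) (2%:E * (h r)%:E) =
    2%:E * \int[lebesgue_measure]_(r in `[0%R, +oo[) (h r)%:E.
  apply: ge0_integralZl => //.
  - by apply/measurable_EFinP; exact: measurable_funTS.
  - by move=> r; rewrite /= in_itv/= andbT => r0; rewrite lee_fin mulr_ge0// expR_ge0.
by rewrite muleA -EFinM; congr (_%:E * _); rewrite /C; ring.
Qed.

End coverage_integral.
End power_law_shot_noise.

(** * The SINR as a function of the received powers *)

Section deterministic_sinr.
Context (R : realType) (y : nat -> R).
Hypothesis y_gt0 : forall i, 0 < y i.
Let s : \bar R := (\sum_(i <oo) (y i)%:E)%E.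
Hypothesis s_fin : (s < +oo)%E.

Let sE : s = (fine s)%:E.
Proof. by rewrite fineK// ge0_fin_numE// nneseries_ge0// => i _ _; rewrite lee_fin ltW. Qed.

(** Strictness comes from one more positive term, that of the index following the larger of the
    two. *)
Lemma lt_addr_nneseries i j : i != j -> y i + y j < fine s.
Proof.
wlog ij : i j / (i < j)%N.
  move=> h ij; have [|ji|ijE] := ltngtP i j; first by move=> ?; exact: h.
    by rewrite addrC; apply: h => //; rewrite eq_sym.
  by rewrite ijE eqxx in ij.
move=> _; rewrite -lte_fin -sE; apply: (@lt_le_trans _ _ (\sum_(0 <= k < j.+2) (y k)%:E)%E); last first.
  by apply: nneseries_lim_ge => k _ _; rewrite lee_fin ltW.
rewrite sumEFin lte_fin big_mkord 2!big_ord_recr/= ltr_pwDr//.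
rewrite lerD2r (bigD1 (Ordinal ij))//= lerDl sumr_ge0// => k _; exact: ltW.
Qed.

Lemma lt_nneseries i : y i < fine s.
Proof.
have /lt_addr_nneseries : i != i.+1 by rewrite ltn_eqF.
by apply: lt_trans; rewrite ltrDl.
Qed.

(** The tails tend to 0, so from some rank on every term is below [y 0], and a maximum over finitely
    many indices is a global one. The infimum of the losses is thus attained. *)
Lemma nneseries_max : exists m, forall i, y i <= y m.
Proof.
have := @nneseries_tail_cvg R (EFin \o y) xpredT.
move=> /(_ s_fin) tl.
have {}tl : (\sum_(k <= i <oo) (y i)%:E @[k --> \oo] --> (0 : \bar R))%E.
  by apply: tl => i _; rewrite lee_fin ltW.
have [n _ nP] : \forall k \near \oo, (\sum_(k <= i <oo) (y i)%:E < (y 0%N)%:E)%E.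
  apply: (tl [set x | x < (y 0%N)%:E]%E); apply: open_nbhs_nbhs; split.
    exact: open_ereal_lt_ereal.
  by rewrite /= lte_fin.
have yn k : (n <= k)%N -> y k <= y 0%N.
  move=> nk; rewrite ltW// -lte_fin; apply: le_lt_trans (nP k nk).
  apply: le_trans (nneseries_lim_ge k.+1 _); last by move=> i _ _; rewrite lee_fin ltW.
  by rewrite big_nat1.
pose m := [arg max_(i > (ord0 : 'I_n.+1)) y i]%O.
have mP (i : 'I_n.+1) : y i <= y m.
  by rewrite /m; case: arg_maxP => // j _; exact.
exists m => i; have [lt_in|le_ni] := ltnP i n.+1; first exact: (mP (Ordinal lt_in)).
by apply: le_trans (mP ord0); apply: yn; exact: ltnW.
Qed.

(** The inequality for an index i becomes weaker as y i grows, so it holds for some i exactly when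
    it holds for the strongest one. The denominator is positive by [lt_nneseries], even for N =
    0. *)
Lemma sinr_ge (N t : R) : 0 <= N -> 0 < t ->
  let L := ereal_inf (range (fun i => ((y i)^-1)%:E)) in
  (t%:E <= L^-1 / (N%:E + (\sum_(0 <= i <oo) (((y i)^-1)%:E)^-1 - L^-1)))%E <->
  exists i, t * (N + (fine s - y i)) <= y i.
Proof.
move=> N0 t0 L; have [m mP] := nneseries_max.
have LE : L = ((y m)^-1)%:E.
  apply/eqP; rewrite eq_le; apply/andP; split.
    by apply: ereal_inf_lbound; exists m.
  apply: le_ereal_inf_tmp => _ [i _ <-]; rewrite lee_fin lef_pV2 ?posrE//.
have invE i : ((((y i)^-1)%:E)^-1 = (y i)%:E)%E.
  by rewrite inver invr_eq0 gt_eqF// invrK.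
have -> : (\sum_(0 <= i <oo) (((y i)^-1)%:E)^-1 = s)%E.
  by apply: eq_eseriesr => i _; rewrite invE.
have D0 : 0 < N + (fine s - y m) by rewrite ltr_wpDl// subr_gt0 lt_nneseries.
rewrite LE invE sE -EFinB -EFinD inver gt_eqF// -EFinM lee_fin ler_pdivlMr//.
split=> [h|[i h]]; first by exists m.
apply: le_trans (mP i); apply: le_trans h; rewrite ler_pM2l// lerD2l lerB//.
Qed.

(** With t >= 1 a covering term is at least half of the sum; two such indices would give s <= y i +
    y j, against [lt_addr_nneseries]. *)
Lemma sinr_ge_unique (N t : R) i j : 0 <= N -> 1 <= t ->
  t * (N + (fine s - y i)) <= y i -> t * (N + (fine s - y j)) <= y j -> i = j.
Proof.
move=> N0 t1; have h k : t * (N + (fine s - y k)) <= y k -> fine s <= y k + y k.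
  have := lt_nneseries k => sk; nra.
move=> /h hi /h hj; apply/eqP/contraT => /lt_addr_nneseries; lra.
Qed.

End deterministic_sinr.

Lemma measure_setD_null d (T : measurableType d) (R : realType)
    (mu : {measure set T -> \bar R}) (B N : set T) :
  measurable B -> measurable N -> mu N = 0%E -> mu (B `\` N) = mu B.
Proof.
move=> mB mN N0; have mBN : measurable (B `\` N) by exact: measurableD.
by rewrite -(measureU0 mBN mN N0) -(measureU0 mB mN N0) setDE setUIl setUCl setIT.
Qed.

Lemma measure_ae_disjoint_bigcup d (T : measurableType d) (R : realType)
    (mu : {measure set T -> \bar R}) (A : set T) (E : nat -> set T) :
  measurable A -> (forall i, measurable (E i)) ->
  {ae mu, forall w, (A w <-> exists i, E i w) /\ (forall i j, E i w -> E j w -> i = j)} ->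
  (mu A = \sum_(i <oo) mu (E i))%E.
Proof.
move=> mA mE [N [mN N0 EN]].
have good w : ~ N w -> (A w <-> exists i, E i w) /\ (forall i j, E i w -> E j w -> i = j).
  by move=> Nw; apply: contrapT => h; apply/Nw/EN.
rewrite -(measure_setD_null mA mN N0) (_ : A `\` N = \bigcup_i (E i `\` N)); last first.
  apply/seteqP; split => w.
    by move=> [Aw Nw]; have [[/(_ Aw) [i Ei] _] _] := good w Nw; exists i.
  by move=> [i _ [Ei Nw]]; have [[_ h] _] := good w Nw; split => //; apply: h; exists i.
rewrite measure_semi_bigcup//.
- by apply: eq_eseriesr => i _; rewrite measure_setD_null.
- by move=> i; exact: measurableD.
- apply/trivIsetP => i j _ _ /eqP ij; apply/seteqP; split => // w [[Ei Nw] [Ej _]].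
  by have [_ /(_ i j Ei Ej)] := good w Nw.
- by apply: bigcup_measurable => i _; exact: measurableD.
Qed.

(** * The Poisson network *)

Section area_set1.
Context (R : realType).
Local Notation GR := (measurableTypeR R).

Let set1_pair (x : R * R) : [set x] = [set x.1] `*` [set x.2].
Proof. by apply/seteqP; split => [_ ->//|[x1 x2] /=]; case: x => ? ? /= [-> ->]. Qed.

Lemma measurable_set1_pair (x : R * R) : measurable ([set x] : set (GR * GR)).
Proof. by rewrite set1_pair; apply: measurableX. Qed.

Lemma area_set1 (x : R * R) : area [set x] = 0%E.
Proof.
rewrite set1_pair /area.
have -> := @product_measure1E _ _ GR GR R lebesgue_measure lebesgue_measure _ _
  (measurable_set1 x.1) (measurable_set1 x.2).
by rewrite [X in (X * _)%E](lebesgue_measure_set1 x.1) mul0e.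
Qed.

End area_set1.

(** * The received power and the area of its superlevel sets *)

Section path_gain.
Context (R : realType) (K beta : R).
Hypotheses (K_gt0 : 0 < K) (beta_gt0 : 0 < beta).
Local Notation GR := (measurableTypeR R).

(* The received power: the reciprocal of the propagation loss when the mark is
   positive, and nonnegative for every mark. *)
Definition path_gain (z : R * R * R) : R :=
  Num.max z.2 0 / (K * euclidean_norm z.1) `^ beta.

Lemma path_gain_ge0 z : 0 <= path_gain z.
Proof. by rewrite divr_ge0 ?powR_ge0// le_max lexx orbT. Qed.

Lemma measurable_path_gain : measurable_fun setT path_gain.
Proof.
apply: measurable_funM; first by apply: measurable_maxr.
apply: (measurableT_comp (@measurable_invr R)).
apply: (measurableT_comp (@measurable_powR R beta)); apply: measurable_funM => //.
exact: (measurableT_comp (@measurable_euclidean_norm R)).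
Qed.

Lemma path_gain_gt0 x s : x != (0, 0) -> 0 < s -> 0 < path_gain (x, s).
Proof.
move=> x0 s0; rewrite /path_gain /= (max_idPl (ltW s0)) divr_gt0// powR_gt0//.
rewrite mulr_gt0// sqrtr_gt0 lt_neqAle addr_ge0 ?sqr_ge0// andbT eq_sym paddr_eq0 ?sqr_ge0//.
by rewrite !sqrf_eq0; case: x x0 => x1 x2; rewrite xpair_eqE.
Qed.

(** With m the positive part of s, the set is the disc |x|^2 <= (m/u)^(2/beta) / K^2 deprived of its
    centre, which has no area. *)
Lemma area_path_gain (u s : R) : 0 < u ->
  area [set x | u <= path_gain (x, s)] =
  (pi / K ^+ 2 * u `^ (- (2 / beta)) * Num.max s 0 `^ (2 / beta))%:E.
Proof.
move=> u0; set m := Num.max s 0; set alpha := 2 / beta.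
have alpha0 : 0 < alpha by rewrite divr_gt0.
have m0 : 0 <= m by rewrite /m le_max lexx orbT.
pose q := (m / u) `^ alpha / K ^+ 2.
have K20 : 0 < K ^+ 2 by rewrite exprn_gt0.
pose n2 (x : R * R) := x.1 ^+ 2 + x.2 ^+ 2.
have setE : [set x | u <= path_gain (x, s)] = [set x | n2 x <= q] `\` [set ((0, 0) : R * R)].
  have n20 x : 0 <= n2 x by rewrite addr_ge0 ?sqr_ge0.
  have n2_gt0 x : x != (0, 0) -> 0 < n2 x.
    move=> x0; rewrite lt_neqAle n20 andbT eq_sym paddr_eq0 ?sqr_ge0// !sqrf_eq0.
    by case: x x0 => x1 x2; rewrite xpair_eqE.
  have key x : x != (0, 0) -> (u <= path_gain (x, s)) = (n2 x <= q).
    move=> x0; have r0 : 0 < Num.sqrt (n2 x) by rewrite sqrtr_gt0 n2_gt0.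
    rewrite /path_gain /= -/m -[euclidean_norm x]/(Num.sqrt (n2 x)).
    set v := K * _; have v0 : 0 < v by rewrite mulr_gt0.
    rewrite ler_pdivlMr ?powR_gt0// mulrC -ler_pdivlMr//.
    have mu0 : 0 <= m / u by rewrite divr_ge0// ltW.
    rewrite -(le_mono_in (gt0_ltr_powR alpha0)) ?nnegrE ?powR_ge0//.
    rewrite -powRrM (_ : beta * alpha = 2%:R); last by rewrite /alpha; field; exact: lt0r_neq0.
    rewrite powR_mulrn ?(ltW v0)// /v exprMn sqr_sqrtr// mulrC -ler_pdivlMr//.
  apply/seteqP; split => x /=.
    (* At the origin the denominator is 0, whose inverse is 0 by convention, so the gain vanishes
       there instead of being infinite. *)
    have [->|x0] := eqVneq x (0, 0); last by rewrite key// => h; split => // x00; rewrite x00 eqxx in x0.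
    rewrite /path_gain /euclidean_norm /= expr0n addr0 sqrtr0 mulr0 powR0 ?gt_eqF//.
    by rewrite invr0 mulr0 leNgt u0.
  by move=> [h /eqP x0]; rewrite key.
have mdisc : measurable [set x : GR * GR | n2 x <= q].
  apply: measurable_is_true; apply: measurable_fun_ler => //.
  by apply: measurable_funD; apply: measurable_funX.
have m00 : measurable ([set ((0, 0) : R * R)] : set (GR * GR)) by exact: measurable_set1_pair.
have area0 := area_set1 ((0, 0) : R * R).
have areaD : area ([set x | n2 x <= q] `\` [set ((0, 0) : R * R)]) = area [set x | n2 x <= q].
  exact: (measure_setD_null mdisc m00 area0).
have qE : q * pi = pi / K ^+ 2 * u `^ (- alpha) * m `^ alpha.
  rewrite /q powRM ?invr_ge0 ?(ltW u0)// -(powR_inv1 (ltW u0)) -powRrM mulN1r; ring.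
rewrite setE areaD -qE.
have : 0 <= q by rewrite divr_ge0 ?powR_ge0// ltW.
(* The radius is 0 only for m = 0; the gain then vanishes everywhere and the set is empty. *)
rewrite le_eqVlt => /predU1P[q0|q0]; last exact: area_disc.
rewrite -areaD -setE; rewrite -q0 mul0r.
have m00' : m = 0.
  move: q0 => /esym/eqP; rewrite /q mulf_eq0 invr_eq0 (gt_eqF K20) orbF powR_eq0.
  by rewrite mulf_eq0 invr_eq0 (gt_eqF u0) orbF => /andP[/eqP].
have -> : [set x | u <= path_gain (x, s)] = set0.
  by apply/seteqP; split => // x /=; rewrite /path_gain/= -/m m00' mul0r leNgt u0.
exact: (measure0 (@lebesgue_measure R \x @lebesgue_measure R)%E).
Qed.
End path_gain.

Section sigma_finite_product.
Context d1 d2 (T1 : measurableType d1) (T2 : measurableType d2) (R : realType).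
Variables (m1 : {sigma_finite_measure set T1 -> \bar R}).
Variables (m2 : {sigma_finite_measure set T2 -> \bar R}).

(* The sigma-finite structure declared on [m1 \x m2] by the library cannot be
   inferred, being masked by the one for products of subprobabilities. *)
Definition sigma_finite_product : set (T1 * T2) -> \bar R := (m1 \x m2)%E.

HB.instance Definition _ := Measure.on sigma_finite_product.

Let sigma_finite_productT : sigma_finite setT sigma_finite_product.
Proof.
have /sigma_finiteP[F [FT ndF Ffin]] := sigma_finiteT m1.
have /sigma_finiteP[G [GT ndG Gfin]] := sigma_finiteT m2.
exists (fun n => F n `*` G n).
  apply/esym/seteqP; split => // -[x y] _.
  have [m _ Fmx] : (\bigcup_n F n) x by rewrite -FT.
  have [n _ Gny] : (\bigcup_n G n) y by rewrite -GT.
  exists (maxn m n) => //; split => /=.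
    by apply: (subsetPset _ _ (ndF _ _ (leq_maxl m n))).
  by apply: (subsetPset _ _ (ndG _ _ (leq_maxr m n))).
move=> n; have [[mF F_fin] [mG G_fin]] := (Ffin n, Gfin n).
split; first exact: measurableX.
by rewrite /sigma_finite_product product_measure1E// lte_mul_pinfty// ge0_fin_numE.
Qed.

HB.instance Definition _ := Measure_isSigmaFinite.Build _ _ _
  sigma_finite_product sigma_finite_productT.

End sigma_finite_product.

(** * The intensity of the received powers and the coverage probability *)

Section poisson_model.
Context (R : realType) (d : measure_display) (T : measurableType d).
Variables (P : probability T R) (lambda K beta : R).
Variables (X : nat -> {mfun T >-> (R * R)%type}) (S : {RV P >-> R}).
Variables (Si : nat -> {RV P >-> R}) (a : R).
Hypotheses (lambda_gt0 : 0 < lambda) (K_gt0 : 0 < K) (beta_gt2 : 2 < beta).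
Hypothesis X_poisson : homogeneous_poisson_process P lambda X.
Hypothesis S_gt0 : {ae P, forall w, 0 < S w}.
Hypothesis S_moment : ('E_P[fun w => (S w `^ (2 / beta))%R] < +oo)%E.
Hypothesis Si_law : forall (i : nat) (B : set R), measurable B ->
  distribution P (Si i) B = distribution P S B.
Hypothesis Si_indep : mutually_independent P Si.
Hypothesis X_Si_indep : independent_families P X Si.
Hypothesis a_def :
  a = lambda * pi * fine 'E_P[fun w => (S w `^ (2 / beta))%R] / K ^+ 2.

Local Notation GR := (measurableTypeR R).
Let alpha := 2 / beta.
Let y := path_gain K beta.
Let mu : {sigma_finite_measure set _ -> \bar R} :=
  @sigma_finite_product _ _ GR GR R lebesgue_measure lebesgue_measure.
Let Y i w := y (X i w, Si i w).
Let beta_gt0 : 0 < beta. Proof. by apply: lt_trans beta_gt2. Qed.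
Let alpha_gt0 : 0 < alpha. Proof. by rewrite divr_gt0. Qed.
Let alpha_lt1 : alpha < 1. Proof. by rewrite ltr_pdivrMr// mul1r. Qed.

Let my : measurable_fun setT (y : GR * GR * R -> R).
Proof. exact: measurable_path_gain. Qed.

Let mYi i : measurable_fun setT (Y i).
Proof.
apply: (measurableT_comp my); apply: measurable_fun_pair; last exact: measurable_funP.
exact: (measurable_funP (X i)).
Qed.

Let myS : measurable_fun setT (fun p : (GR * GR) * T => y (p.1, S p.2)).
Proof.
apply: (measurableT_comp my); apply: measurable_fun_pair => //.
exact: (measurableT_comp (measurable_funP S)).
Qed.

Let lambdaN : {nonneg R} := NngNum (ltW lambda_gt0).

(** The intensity of the received powers: the image of lambda dx times the law of [S] under the
    gain, the law of [S] being represented by [P] on [T]. *)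
Let Lam : {measure set R -> \bar R} := image_measure (mscale lambdaN (mu \x P)%E) myS.

Let integral_Lam (f : R -> \bar R) : measurable_fun setT f -> (forall x, 0 <= f x)%E ->
  (\int[Lam]_x f x = lambda%:E * \int[mu \x P]_p f (y (p.1, S p.2)))%E.
Proof.
move=> mf f0; rewrite ge0_integral_pushforward// preimage_setT ge0_integral_mscale//=.
exact: (measurableT_comp mf myS).
Qed.

Let laplaceY (H : R -> R) : measurable_fun setT H -> (forall y, (0 <= H y)%R) ->
  (\int[P]_w expeR (- \sum_(i <oo) (H (Y i w))%:E) =
  expeR (- \int[Lam]_y (1 - expR (- H y))%:E))%E.
Proof.
move=> mH H0.
have mG : measurable_fun setT (fun x => (1 - expR (- H x))%:E).
  apply/measurable_EFinP; apply: measurable_funB => //.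
  by apply: measurableT_comp; [exact: measurable_expR|exact: measurable_funN].
have G0 x : (0 <= (1 - expR (- H x))%:E)%E.
  by rewrite lee_fin subr_ge0 -[leRHS]expR0 ler_expR lerNl oppr0.
have mX i : measurable_fun setT (X i : T -> GR * GR) by exact: (measurable_funP (X i)).
have mZ i : measurable_fun setT (Si i) by exact: measurable_funP.
have := @laplace_marked_poisson_process _ _ R P _ _ mu (fun i => X i) lambda mX
  (ltW lambda_gt0) X_poisson.1 X_poisson.2 _ _ (fun i => Si i) S (H \o y)
  mZ (measurable_funP S) Si_law Si_indep X_Si_indep (measurableT_comp mH my) (fun z => H0 _).
move=> /= ->; rewrite integral_Lam//; congr (expeR (- (_ * _))).
have mF : measurable_fun setT (fun p : GR * GR * T => (1 - expR (- H (y (p.1, S p.2))))%:E).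
  exact: (measurableT_comp mG myS).
by rewrite -(@fubini_tonelli1 _ _ _ _ _ mu P _ mF).
Qed.

(** For a fixed mark the section is the set measured by [area_path_gain]; averaging its area over
    the mark brings in E S^(2/beta). *)
Let LamE u : 0 < u -> Lam `[u, +oo[%classic = (a * u `^ (- alpha))%:E.
Proof.
move=> u0; rewrite /Lam /= /pushforward /mscale /=.
pose A : set (GR * GR * T)%type := [set p | u <= y (p.1, S p.2)].
have mA : measurable A by apply: measurable_is_true; exact: measurable_fun_ler.
rewrite (_ : _ @^-1` _ = A); last first.
  by apply/seteqP; split => p /=; rewrite in_itv/= andbT.
rewrite (@product_measure2_eq _ _ _ _ _ mu P _ mA).
have mSp : measurable_fun setT (fun w => (S w `^ alpha)%:E).
  apply/measurable_EFinP; apply: (measurableT_comp (@measurable_powR R alpha)).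
  exact: measurable_funP.
have c0 : 0 <= pi / K ^+ 2 * u `^ (- alpha).
  by rewrite mulr_ge0 ?powR_ge0// divr_ge0 ?pi_ge0// exprn_ge0// ltW.
have -> : (\int[P]_w mu (ysection A w) =
    \int[P]_w ((pi / K ^+ 2 * u `^ (- alpha))%:E * (S w `^ alpha)%:E))%E.
  apply: ge0_ae_eq_integral => //.
  - exact: (@measurable_fun_ysection _ _ _ _ _ mu A mA).
  - exact: emeasurable_funM.
  - by move=> w _; rewrite mule_ge0 ?lee_fin ?powR_ge0.
  apply: filterS S_gt0 => w Sw _.
  rewrite -EFinM -[in RHS](max_idPl (ltW Sw)) -(area_path_gain K_gt0 beta_gt0)//.
  congr (mu _); apply/seteqP; split => x; rewrite /ysection /= inE//.
rewrite ge0_integralZl//; last by move=> w _; rewrite lee_fin powR_ge0.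
rewrite -[X in (_ * (_ * X))%E]fineK; last first.
  rewrite ge0_fin_numE; last by apply: integral_ge0 => w _; rewrite lee_fin powR_ge0.
  by have := S_moment; rewrite unlock.
rewrite -!EFinM a_def unlock; congr EFin; rewrite -/alpha; ring.
Qed.

Let a_gt0 : 0 < a.
Proof.
rewrite a_def mulr_gt0 ?invr_gt0 ?exprn_gt0// !mulr_gt0 ?pi_gt0// fine_gt0// S_moment andbT.
rewrite unlock; apply: integral_gt0 => //.
- by rewrite [X in (_ < X)%E](@probability_setT _ _ _ P).
- apply/measurable_EFinP; apply: (measurableT_comp (@measurable_powR R alpha)).
  exact: measurable_funP.
- by move=> w; rewrite lee_fin powR_ge0.
- by apply: filterS S_gt0 => w Sw; rewrite lte_fin powR_gt0.
Qed.

(** By the layer formula and [LamE] the exponent is the integral of exp (- v) a (v/z)^(-alpha) over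
    v > 0, which converges at 0 because beta > 2 makes alpha < 1. *)
Let exponentE z : (0 < z)%R ->
  (\int[Lam]_y (1 - expR (- (z * Num.max y 0)))%:E =
   (a * z `^ alpha * Gamma (1 - alpha))%:E)%E.
Proof.
move=> z0.
pose Y' (p : GR * GR * T) := z * y (p.1, S p.2).
have Y'0 p : 0 <= Y' p by rewrite mulr_ge0 ?(ltW z0)// path_gain_ge0.
have mY' : measurable_fun setT Y' by exact: measurable_funM.
rewrite integral_Lam; last 2 first.
- apply/measurable_EFinP; apply: measurable_funB => //.
  apply: measurableT_comp; first exact: measurable_expR.
  by apply: measurable_funN; apply: measurable_funM => //; exact: measurable_maxr.
- move=> x; rewrite lee_fin subr_ge0 -[leRHS]expR0 ler_expR lerNl oppr0.
  by rewrite mulr_ge0 ?(ltW z0)// le_max lexx orbT.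
transitivity (lambda%:E * \int[sigma_finite_product mu P]_p (1 - expR (- Y' p))%:E)%E.
  congr (_ * _)%E; apply: eq_integral => p _.
  by rewrite /Y' (max_idPl _)//; exact: path_gain_ge0.
rewrite (@integral_onem_expRN_layer R _ _ (sigma_finite_product mu P) Y' mY' Y'0).
transitivity (lambda%:E * \int[lebesgue_measure]_(v in `]0%R, +oo[)
    ((a * z `^ alpha / lambda)%:E * (v `^ (1 - alpha - 1) * expR (- v))%:E))%E.
  congr (_ * _)%E; apply: eq_integral => v; rewrite inE/= in_itv/= andbT => v0.
  have h := LamE (divr_gt0 v0 z0).
  have -> : sigma_finite_product mu P [set p | v <= Y' p] = (a * (v / z) `^ (- alpha) / lambda)%:E.
    rewrite EFinM -h muleC /Lam /= /pushforward /mscale /= muleA -EFinM mulVf ?gt_eqF// mul1e.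
    congr ((mu \x P)%E _); apply/seteqP; split => p /=;
      by rewrite in_itv/= andbT ler_pdivrMr// mulrC.
  rewrite -!EFinM; congr EFin.
  rewrite powRM ?invr_ge0 ?(ltW v0) ?(ltW z0)// -(powR_inv1 (ltW z0)) -powRrM mulrNN mul1r.
  rewrite (_ : 1 - alpha - 1 = - alpha); ring.
have -> : (\int[lebesgue_measure]_(v in `]0%R, +oo[)
      ((a * z `^ alpha / lambda)%:E * (v `^ (1 - alpha - 1) * expR (- v))%:E) =
    (a * z `^ alpha / lambda)%:E * \int[lebesgue_measure]_(v in `]0%R, +oo[)
      (v `^ (1 - alpha - 1) * expR (- v))%:E)%E.
  apply: ge0_integralZl => //.
  - apply/measurable_EFinP/measurable_funTS; apply: measurable_funM; first exact: measurable_powR.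
    by apply: measurableT_comp; [exact: measurable_expR|exact: measurable_funN].
  - by move=> v _; rewrite lee_fin mulr_ge0 ?powR_ge0// expR_ge0.
  - by rewrite lee_fin divr_ge0 ?mulr_ge0 ?powR_ge0 ?ltW.
rewrite GammaE -?EFinM; last first.
  by have a0 := alpha_gt0; have a1 := alpha_lt1; apply/andP; split; lra.
by congr EFin; field; exact: lt0r_neq0.
Qed.

Let Y_ge0 i w : 0 <= Y i w. Proof. exact: path_gain_ge0. Qed.

(** The count of points at the origin is Poisson of mean 0, hence 0 almost surely; this uses the
    explicit weights at rate 0, with 0^0 = 1. *)
Let X_neq0 : {ae P, forall w, forall i, X i w != (0, 0)}.
Proof.
pose O : set (R * R) := [set (0, 0)].
have mO : measurable (O : set (GR * GR)) by exact: measurable_set1_pair.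
pose C := count_points X O @^-1` [set 0%:R%:E].
have mcount : measurable_fun setT (count_points X O).
  apply: ge0_emeasurable_sum => [i w _ _|i _]; first by rewrite lee_fin.
  apply/measurable_EFinP; apply: (measurableT_comp (measurable_indic mO)).
  exact: (measurable_funP (X i)).
have mC : measurable C.
  by rewrite -[C]setTI; apply: mcount => //; exact: emeasurable_set1.
have PC : P C = 1%E.
  rewrite (X_poisson.1 O mO _ 0%N) ?area_set1//=.
  by rewrite mulr0 expr0 fact0 divr1 oppr0 expR0 mulr1.
exists (~` C); split; first exact: measurableC.
  by rewrite probability_setC// PC subee.
move=> w /= hw Cw; apply: hw => i; apply/eqP => Xi0.
have : (1 <= count_points X O w)%E.
  apply: le_trans (nneseries_lim_ge i.+1 _); last by move=> n _ _; rewrite lee_fin.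
  rewrite big_mkord big_ord_recr/= indicE mem_set//.
  by rewrite leeDr// sume_ge0// => j _; rewrite lee_fin.
by rewrite Cw lee_fin ler10.
Qed.

(** Positivity of [S] is a statement about its law, shared by each mark; countably many null events
    are then united. *)
Let Si_gt0 : {ae P, forall w, forall i, 0 < Si i w}.
Proof.
apply/ae_foralln => i.
have mB : measurable (`]-oo, 0%R] : set R) by exact: measurable_itv.
have mS (S' : {RV P >-> R}) : measurable (S' @^-1` `]-oo, 0%R]).
  by rewrite -[X in measurable X]setTI; exact: measurable_funP.
have S0 : P (S @^-1` `]-oo, 0%R]) = 0%E.
  have [N [mN N0 SN]] := S_gt0.
  apply: (@subset_measure0 _ _ _ _ _ N) => // w /=.
  by rewrite in_itv/= => Sw; apply: SN => /= S'; move: Sw; rewrite leNgt S'.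
exists (Si i @^-1` `]-oo, 0%R]); split => //.
  by rewrite -[LHS]/(distribution P (Si i) _) Si_law.
by move=> w /= /negP; rewrite -leNgt in_itv/=.
Qed.

Let Y_gt0 : {ae P, forall w, forall i, 0 < Y i w}.
Proof. by apply: filterS2 X_neq0 Si_gt0 => w X0 S0 i; exact: path_gain_gt0. Qed.

Let Ir w : R := fine (\sum_(i <oo) (Y i w)%:E)%E.

Let I_fin : {ae P, forall w, (\sum_(i <oo) (Y i w)%:E < +oo)%E} :=
  shot_noise_fin mYi laplaceY Y_ge0 a_gt0 alpha_gt0 exponentE.

Let mIr : measurable_fun setT Ir.
Proof.
apply: measurableT_comp => //.
apply: ge0_emeasurable_sum => [i w _ _|i _]; first by rewrite lee_fin.
by apply/measurable_EFinP.
Qed.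

Section coverage_probability.
Variables (N t : R).
Hypotheses (N_ge0 : 0 <= N) (t_ge1 : 1 <= t).

Let t_gt0 : 0 < t. Proof. exact: lt_le_trans t_ge1. Qed.

(* As t >= 1, at most one station can cover the origin. *)
Let coverage_sum : P [set w | (t%:E <= SINR K beta N X Si w)%E] =
  (\sum_(i <oo) P [set w | (0 < Y i w)%R /\
     (t * (N + Num.max (Ir w - Y i w) 0) <= Y i w)%R])%E.
Proof.
apply: measure_ae_disjoint_bigcup.
- rewrite -[X in measurable X]setTI; apply: emeasurable_fun_c_infty => //.
  apply: measurable_SINR => i; first exact: (measurable_funP (X i)).
  exact: (measurable_funP (Si i)).
- move=> i; apply: measurableI; apply: measurable_is_true.
    exact: measurable_fun_ltr.
  apply: measurable_fun_ler => //; apply: measurable_funM => //.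
  apply: measurable_funD => //; apply: measurable_maxr => //.
  exact: measurable_funB.
have : {ae P, forall w, (forall i, X i w != (0, 0)) /\ (forall i, 0 < Si i w)}.
  by apply: filterS2 X_neq0 Si_gt0.
apply: filterS2 I_fin => w Iw [X0 S0].
have Yw i : 0 < Y i w by exact: path_gain_gt0.
have YI i : Num.max (Ir w - Y i w) 0 = Ir w - Y i w.
  by apply/max_idPl; rewrite subr_ge0 ltW// lt_nneseries.
have lossE i : loss K beta X Si i w = ((Y i w)^-1)%:E.
  by rewrite /loss /propagation_loss /Y /y /path_gain /= (max_idPl (ltW (S0 i))) invf_div.
split => /=.
  have -> : SINR K beta N X Si w =
      (let L := ereal_inf (range (fun i => ((Y i w)^-1)%:E)) in
       (L^-1 / (N%:E + (\sum_(0 <= i <oo) (((Y i w)^-1)%:E)^-1 - L^-1))))%E.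
    rewrite /SINR /path_loss_factor (_ : loss K beta X Si ^~ w = fun i => ((Y i w)^-1)%:E).
      by under eq_eseriesr do rewrite lossE.
    by apply/funext => i.
  have := @sinr_ge R (Y ^~ w) Yw Iw N t N_ge0 t_gt0 => /= ->.
  by split=> [[i h]|[i [_ h]]]; exists i; rewrite ?YI// in h *.
move=> i j /= [_ hi] [_ hj]; rewrite YI in hi; rewrite YI in hj.
exact: (@sinr_ge_unique R (Y ^~ w) Yw Iw N t).
Qed.

Lemma coverage_probability : P [set w | (t%:E <= SINR K beta N X Si w)%E] =
  ((2 * t `^ (- (2 / beta)) / Gamma (1 + 2 / beta))%R%:E *
   \int[lebesgue_measure]_(r in `[0%R, +oo[)
     (r * expR (- (r ^+ 2 * Gamma (1 - 2 / beta))
                - N * a `^ (- (beta / 2)) * r `^ beta))%R%:E)%E.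
Proof.
rewrite coverage_sum.
rewrite (@sum_coverage _ _ R P Y Lam a alpha (Gamma (1 - alpha)))//.
apply: (@coverage_integral _ _ R P Y Lam a alpha (Gamma (1 - alpha))) => //.
exact: ltW.
Qed.

End coverage_probability.
End poisson_model.

Theorem mainTheorem5 (R : realType) (d : measure_display) (T : measurableType d)
    (P : probability T R) (lambda K beta N : R)
    (X : nat -> {mfun T >-> (R * R)%type}) (S : {RV P >-> R})
    (Si : nat -> {RV P >-> R}) (a : R)
    (lambda_gt0 : 0 < lambda) (K_gt0 : 0 < K) (beta_gt2 : 2 < beta)
    (N_ge0 : 0 <= N)
    (X_poisson : homogeneous_poisson_process P lambda X)
    (S_gt0 : {ae P, forall w, 0 < S w})
    (S_moment : ('E_P[fun w => (S w `^ (2 / beta))%R] < +oo)%E)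
    (Si_law : forall (i : nat) (B : set R), measurable B ->
      distribution P (Si i) B = distribution P S B)
    (Si_indep : mutually_independent P Si)
    (X_Si_indep : independent_families P X Si)
    (a_def : a = lambda * pi * fine 'E_P[fun w => (S w `^ (2 / beta))%R] / K ^+ 2)
    (t : R) (t_ge1 : 1 <= t) :
  P [set w | (t%:E <= SINR K beta N X Si w)%E] =
  ((2 * t `^ (- (2 / beta)) / Gamma (1 + 2 / beta))%R%:E *
   \int[lebesgue_measure]_(r in `[0%R, +oo[)
     (r * expR (- (r ^+ 2 * Gamma (1 - 2 / beta))
                - N * a `^ (- (beta / 2)) * r `^ beta))%R%:E)%E.
Proof.
exact: (coverage_probability lambda_gt0 K_gt0 beta_gt2 X_poisson S_gt0 S_moment
  Si_law Si_indep X_Si_indep a_def N_ge0 t_ge1).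
Qed.
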